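(* For each $c\in P$, the support of any minimizing probability measure for $$\inf_{\mu_\delta\in\mathcal{P}_\delta}\int_{\mathbb{T}^d\times\mathbb{T}\times\mathbb{R}^d}L^{(c)}(x,t-\tau,\zeta)\,d\mu_\delta\ \big(=-\bar H_\delta(c)\big)$$ is contained in the set $$\mathcal{A}_\delta(c):=\bigcap_{\bar v(c)}\Big\{\big(x_m,t_{k+1},H_p(x_m,t_k,c+(D_x\bar v)^k_m)\big)\ \Big|\ (x_m,t_{k+1})\in{\rm pr.}\,\tilde{\mathcal{G}}_\delta\Big\},$$ where the intersection is taken over all time-$1$-periodic solutions $\bar v=\bar v(c)$ of the discrete cell equation; namely, $$\mathcal{M}_\delta(c)\subset\mathcal{A}_\delta(c)\subset{\rm pr.}\,\tilde{\mathcal{G}}_\delta\times[-(d\lambda)^{-1},(d\lambda)^{-1}]^d.$$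
   Context: Lagrangian: $\mathbb{T}=\mathbb{R}/\mathbb{Z}$, $\mathbb{T}^d=\mathbb{R}^d/\mathbb{Z}^d$; functions on tori are identified with $1$-periodic functions. $|x|_\infty=\max_j|x^j|$, $|\cdot|$ is the Euclidean norm. $L=L(x,t,\zeta):\mathbb{T}^d\times\mathbb{T}\times\mathbb{R}^d\to\mathbb{R}$ is $C^2$; $L_{\zeta\zeta}$ is positive definite everywhere; for each $a\ge0$ there is $b_1(a)\in\mathbb{R}$ with $L\ge a|\zeta|+b_1(a)$ everywhere; there is $\alpha>0$ with $|L_{x^j}|\le\alpha(1+|L|)$ everywhere ($j=1,\dots,d$). $H(x,t,p)=\sup_{\zeta\in\mathbb{R}^d}(p\cdot\zeta-L(x,t,\zeta))$, $L^{(c)}(x,t,\zeta)=L(x,t,\zeta)-c\cdot\zeta$. $P\subset\mathbb{R}^d$ is a fixed compact convex set and $r>0$ is a fixed number. Grid: $\delta=(h,\tau)$, $h=(2N)^{-1}$, $\tau=(2K)^{-1}$ with $N,K\in\mathbb{N}$, $\lambda=\tau/h$; $x_m=hm$ ($m\in\mathbb{Z}^d$), $t_k=\tau k$ ($k\in\mathbb{Z}$). $G_{\rm even}$ (resp. $G_{\rm odd}$) is the set of $x_m$ with $m^1+\dots+m^d$ even (resp. odd). $\mathcal{G}_\delta=\bigcup_{k}\{(G_{\rm even}\times\{t_{2k}\})\cup(G_{\rm odd}\times\{t_{2k+1}\})\}$, $\tilde{\mathcal{G}}_\delta=\bigcup_{k}\{(G_{\rm odd}\times\{t_{2k}\})\cup(G_{\rm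 even}\times\{t_{2k+1}\})\}$; ${\rm pr.}\,\tilde{\mathcal{G}}_\delta$ is the set of $(x_m,t_k)\in\tilde{\mathcal{G}}_\delta$ with $0\le m^i\le2N-1$, $0\le k\le2K-1$ (regarded as a subset of $\mathbb{T}^d\times\mathbb{T}$). $e_1,\dots,e_d$ is the standard basis, $B=\{\pm e_1,\dots,\pm e_d\}$. For a grid point $x$, $m(x)$ is its index. For $v:\tilde{\mathcal{G}}_\delta\to\mathbb{R}$ write $v^k_m=v(x_m,t_k)$ and, for $(x_m,t_k)\in\mathcal{G}_\delta$, $(D_{x^j}v)^k_m=\frac{v^k_{m+e_j}-v^k_{m-e_j}}{2h}$, $D_xv=(D_{x^1}v,\dots,D_{x^d}v)$, $(D_tv)^{k+1}_m=\frac1\tau\big(v^{k+1}_m-\frac1{2d}\sum_{\omega\in B}v^k_{m+\omega}\big)$. Solution map: $X_\delta$ is the set of $w:G_{\rm odd}\to\mathbb{R}$, $1$-periodic in each coordinate, with $|D_xw|_\infty\le r$ on $G_{\rm even}$. For $v^0\in X_\delta$, $c\in P$, $\varphi^k_\delta(v^0;c)=v(\cdot,t_k)$, where $(D_tv)^{k+1}_m+H(x_m,t_k,c+(D_xv)^k_m)=0$, $v(\cdot,0)=v^0$; $\varphi_\delta=\varphi^{2K}_\delta$. $\bar H_\delta(c)$ is the unique real number for which some $\bar v^0\in X_\delta$ satisfies $\varphi_\delta(\bar v^0;c)+\bar H_\delta(c)=\bar v^0$. Standing assumption: $r$ is large enough and $\delta$ small enough, with $\lambda<\lambda_1$ for a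 constant $\lambda_1=\lambda_1(r,P)>0$, so that for every $c\in P$ and $v^0\in X_\delta$, $\varphi_\delta(\cdot;c)$ maps $X_\delta$ into itself and $|H_p(x_m,t_k,c+(D_xv)^k_m)|_\infty\le(d\lambda_1)^{-1}<(d\lambda)^{-1}$ for all $k\ge0$, $m$, where $v$ is the solution with initial datum $v^0$. A time-$1$-periodic solution $\bar v(c)$ of the discrete cell equation is a function $\bar v:\tilde{\mathcal{G}}_\delta\to\mathbb{R}$, $1$-periodic in each space coordinate and in time, with $\bar v(\cdot,0)\in X_\delta$ and $(D_t\bar v)^{k+1}_m+H(x_m,t_k,c+(D_x\bar v)^k_m)=\bar H_\delta(c)$. Measures: an admissible control is a function $\xi:{\rm pr.}\,\tilde{\mathcal{G}}_\delta\to[-(d\lambda)^{-1},(d\lambda)^{-1}]^d$, identified with its $1$-periodic extension (in space and time) to $\tilde{\mathcal{G}}_\delta$; $\xi^k_m=\xi(x_m,t_k)$. Fix a starting point $x_{n_0}\in G_{\rm odd}$. For $l\in\mathbb{N}$ consider the backward random walk $(\gamma^k)_{-l\le k\le0}$ with $\gamma^0=x_{n_0}$ jumping from $(x_m,t_{k+1})$ to $(x_m+h\omega,t_k)$ with probability $\frac1{2d}-\frac\lambda2\omega\cdot\xi^{k+1}_m$, $\omega\in B$, with expectation $E$. Let $\mu^l_\delta(\xi)$ be the probability measure on $\mathbb{T}^d\times\mathbb{T}\times\mathbb{R}^d$ with $\int f\,d\mu^l_\delta(\xi)=E\big[\frac1{t_l}\sum_{-l<k\le0}f(\gamma^k,t_k,\xi^k_{m(\gamma^k)})\tau\big]$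 for all $f\in C_c(\mathbb{T}^d\times\mathbb{T}\times\mathbb{R}^d;\mathbb{R})$. $\mathcal{P}_\delta$ is the family of all probability measures that are weak limits of subsequences of $\{\mu^l_\delta(\xi)\}_{l\in\mathbb{N}}$ as $l\to\infty$, for all admissible controls $\xi$. The Mather-type set $\mathcal{M}_\delta(c)$ is the union of ${\rm supp}(\mu^*_\delta)$ over all minimizers $\mu^*_\delta\in\mathcal{P}_\delta$ of the minimizing problem $\inf_{\mu_\delta\in\mathcal{P}_\delta}\int_{\mathbb{T}^d\times\mathbb{T}\times\mathbb{R}^d}L^{(c)}(x,t-\tau,\zeta)\,d\mu_\delta$. *)

(* Defs.v *)
From HB Require Import structures.
From mathcomp Require Import all_boot all_order all_algebra.
From mathcomp Require Import all_classical all_reals all_analysis.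

Set Implicit Arguments.
Unset Strict Implicit.
Unset Printing Implicit Defensive.

Import Order.TTheory GRing.Theory Num.Theory.
Import numFieldNormedType.Exports.

Local Open Scope classical_set_scope.
Local Open Scope ring_scope.

Section Torus.
Context (R : realType) (d : nat).

Definition torus_rel (x y : 'rV[R]_d) : bool :=
  [forall j, (x 0 j - y 0 j) \is a Num.int].

Lemma torus_rel_refl : reflexive torus_rel.
Proof. by move=> x; apply/forallP => j; rewrite subrr rpred0. Qed.

Lemma torus_rel_sym : symmetric torus_rel.
Proof.
by move=> x y; apply/forallP/forallP => xy j; rewrite -opprB rpredN.
Qed.

Lemma torus_rel_trans : transitive torus_rel.
Proof.
move=> y x z /forallP xy /forallP yz; apply/forallP => j.
by rewrite -(subrKA (y 0 j)) rpredD.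
Qed.

Canonical torus_equiv :=
  EquivRel torus_rel torus_rel_refl torus_rel_sym torus_rel_trans.

Definition torus := quotient_topology {eq_quot torus_rel}%qT.
HB.instance Definition _ := PointedTopological.on torus.

Definition to_torus (x : 'rV[R]_d) : torus := (\pi_{eq_quot torus_rel} x)%qT.
Definition of_torus (x : torus) : 'rV[R]_d := repr (x : {eq_quot torus_rel}%qT).

End Torus.

Section Circle.
Context (R : realType).

Definition circle_rel (s t : R) : bool := (s - t) \is a Num.int.

Lemma circle_rel_refl : reflexive circle_rel.
Proof. by move=> x; rewrite /circle_rel subrr rpred0. Qed.

Lemma circle_rel_sym : symmetric circle_rel.
Proof. by move=> x y; rewrite /circle_rel -opprB rpredN. Qed.

Lemma circle_rel_trans : transitive circle_rel.
Proof. by move=> y x z xy yz; rewrite /circle_rel -(subrKA y) rpredD. Qed.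

Canonical circle_equiv :=
  EquivRel circle_rel circle_rel_refl circle_rel_sym circle_rel_trans.

Definition circle := quotient_topology {eq_quot circle_rel}%qT.
HB.instance Definition _ := PointedTopological.on circle.

Definition to_circle (t : R) : circle := (\pi_{eq_quot circle_rel} t)%qT.
Definition of_circle (t : circle) : R := repr (t : {eq_quot circle_rel}%qT).

End Circle.

Notation phase_space R d := (torus R d * circle R * 'rV[R]_d)%type.
Notation Borel_phase R d := (g_sigma_algebraType (@open (phase_space R d))).

(** In finite dimension, [C^k] in the usual sense amounts to the existence and
    continuity of the directional derivatives up to order [k]. *)
Fixpoint Ck (R : realType) (V : normedModType R) (k : nat) (f : V -> R) : Prop :=
  continuous f /\
  if k is k'.+1 then
    forall v : V, (forall x, derivable f x v) /\ Ck k' (fun x => 'D_v f x)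
  else True.

Section Vectors.
Context (R : realType) (d : nat).

Definition dotp (u v : 'rV[R]_d) : R := \sum_j u 0 j * v 0 j.
Definition enorm (u : 'rV[R]_d) : R := Num.sqrt (\sum_j u 0 j ^+ 2).
Definition grad (f : 'rV[R]_d -> R) (p : 'rV[R]_d) : 'rV[R]_d :=
  \row_j 'D_(delta_mx 0 j) f p.
Definition hess (f : 'rV[R]_d -> R) (p : 'rV[R]_d) : 'M[R]_d :=
  \matrix_(i, j) 'D_(delta_mx 0 i) (fun q => 'D_(delta_mx 0 j) f q) p.
Definition posdef (A : 'M[R]_d) : Prop :=
  forall v : 'rV[R]_d, v != 0 -> 0 < (v *m A *m v^T) 0 0.

End Vectors.

Section Lagrangian.
Context (R : realType) (d : nat).
Implicit Types (L : 'rV[R]_d * R * 'rV[R]_d -> R) (x p zeta c : 'rV[R]_d) (t : R).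

(** Functions on the tori are 1-periodic functions on [R^d * R]. *)
Record Lagrangian_hyps L : Prop := {
  L_periodic_x : forall x t zeta j,
    L (x + delta_mx 0 j, t, zeta) = L (x, t, zeta);
  L_periodic_t : forall x t zeta, L (x, t + 1, zeta) = L (x, t, zeta);
  L_C2 : Ck 2 L;
  L_convex : forall x t zeta, posdef (hess (fun z => L (x, t, z)) zeta);
  L_superlinear : forall a : R, 0 <= a -> exists b1 : R,
    forall x t zeta, a * enorm zeta + b1 <= L (x, t, zeta);
  L_growth : exists2 alpha : R, 0 < alpha & forall x t zeta (j : 'I_d),
    `|grad (fun y => L (y, t, zeta)) x 0 j| <= alpha * (1 + `|L (x, t, zeta)|)
}.

Definition Ham L x t p : R :=
  sup (range (fun zeta => dotp p zeta - L (x, t, zeta))).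
Definition Ham_p L x t p : 'rV[R]_d := grad (Ham L x t) p.

Definition Lc L c x t zeta : R := L (x, t, zeta) - dotp c zeta.

End Lagrangian.

(** A grid point [(x_m, t_k)] is represented by its index [(m, k)], and a
    function on a (sub)grid by a function of all the indices; every condition
    below only involves the values on the relevant (sub)grid. *)

Section Scheme.
Context (R : realType) (d N K : nat).
Variable L : 'rV[R]_d * R * 'rV[R]_d -> R.
Variable r : R.

Notation index := 'rV[int]_d.

Definition h : R := (N.*2)%:R^-1.
Definition tau : R := (K.*2)%:R^-1.
Definition lam : R := tau / h.

Definition xg (m : index) : 'rV[R]_d := h *: map_mx intr m.
Definition tg (k : int) : R := tau * k%:~R.

Definition ei (j : 'I_d) : index := delta_mx 0 j.

(** [(j, false)] stands for [e_j] and [(j, true)] for [- e_j]. *)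
Definition Bset := ('I_d * bool)%type.
Definition dir (w : Bset) : index := (-1) ^+ w.2 *: ei w.1.

Definition ievenx (m : index) : bool := (2 %| \sum_j m 0 j)%Z.
Definition ievent (k : int) : bool := (2 %| k)%Z.
Definition grid (m : index) (k : int) : bool := ievenx m == ievent k.
Definition tgrid (m : index) (k : int) : bool := ievenx m != ievent k.
Definition pr_tgrid (m : index) (k : int) : Prop :=
  [/\ tgrid m k, (forall j, 0 <= m 0 j <= (N.*2)%:Z - 1)
    & 0 <= k <= (K.*2)%:Z - 1].

Definition Dx (w : index -> R) (m : index) : 'rV[R]_d :=
  \row_j ((w (m + ei j) - w (m - ei j)) / (2 * h)).
Definition avg (w : index -> R) (m : index) : R :=
  (2 * d%:R)^-1 * \sum_(o : Bset) w (m + dir o).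
(** [Dt v m k] is [(D_t v)^k_m]: the upper index is the later time. *)
Definition Dt (v : index -> int -> R) (m : index) (k : int) : R :=
  tau^-1 * (v m k - avg (v^~ (k - 1)) m).

(** The norm of ['rV[R]_d] is the maximum norm. *)
Definition Xset : set (index -> R) := [set w |
  (forall m j, ~~ ievenx m -> w (m + (N.*2)%:Z *: ei j) = w m) /\
  (forall m, ievenx m -> `|Dx w m| <= r)].

(** The scheme [(D_t v)^{k+1}_m + H(x_m, t_k, c + (D_x v)^k_m) = 0] solved
    for [v^{k+1}_m]; see [phi_scheme]. *)
Fixpoint phi (v0 : index -> R) (c : 'rV[R]_d) (k : nat) : index -> R :=
  if k is k'.+1 then fun m =>
    avg (phi v0 c k') m - tau * Ham L (xg m) (tg k') (c + Dx (phi v0 c k') m)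
  else v0.

Lemma phi_scheme v0 c (v : index -> int -> R) (m : index) (k : nat) :
  (0 < K)%N -> (forall m' (k' : nat), v m' k' = phi v0 c k' m') ->
  Dt v m k.+1 + Ham L (xg m) (tg k) (c + Dx (v^~ (k : int)) m) = 0.
Proof.
move=> K0 vE; rewrite /Dt -addn1 PoszD addrK -PoszD addn1 vE /=.
have -> : v^~ (k : int) = phi v0 c k by apply/funext => m'; rewrite vE.
have tau0 : tau != 0 by rewrite invr_eq0 pnatr_eq0 double_eq0 -lt0n.
by rewrite addrAC subrr sub0r mulrN mulKf// addNr.
Qed.

Definition effective_H (c : 'rV[R]_d) : R :=
  xget 0 [set Hb | exists2 v0, Xset v0 &
    forall m, ~~ ievenx m -> phi v0 c K.*2 m + Hb = v0 m].

Definition standing (P : set 'rV[R]_d) (lam1 : R) : Prop :=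
  forall c, P c -> forall v0, Xset v0 ->
    Xset (phi v0 c K.*2) /\
    forall (m : index) (k : nat), grid m k ->
      `|Ham_p L (xg m) (tg k) (c + Dx (phi v0 c k) m)| <= (d%:R * lam1)^-1.

Definition periodic_on_tgrid (T : Type) (v : index -> int -> T) : Prop :=
  forall m k, tgrid m k ->
    (forall j, v (m + (N.*2)%:Z *: ei j) k = v m k) /\
    v m (k + (K.*2)%:Z) = v m k.

Definition cell_solution (c : 'rV[R]_d) (v : index -> int -> R) : Prop :=
  [/\ periodic_on_tgrid v, Xset (v^~ 0)
    & forall m k, grid m k ->
        Dt v m (k + 1) + Ham L (xg m) (tg k) (c + Dx (v^~ k) m)
        = effective_H c].


Definition phase_pt (m : index) (k : int) (zeta : 'rV[R]_d) : phase_space R d :=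
  (to_torus (xg m), to_circle (tg k), zeta).

Definition admissible (xi : index -> int -> 'rV[R]_d) : Prop :=
  periodic_on_tgrid xi /\
  forall m k, tgrid m k -> forall j,
    - (d%:R * lam)^-1 <= xi m k 0 j <= (d%:R * lam)^-1.

Variable n0 : index.
Implicit Types xi : index -> int -> 'rV[R]_d.

(** Probability of the jump from [(x_m, t_k)] to [(x_m + h o, t_{k-1})]. *)
Definition jump xi (m : index) (k : int) (o : Bset) : R :=
  (2 * d%:R)^-1 - lam / 2 * dotp (map_mx intr (dir o)) (xi m k).

(** A realization of the walk is the sequence of its [l] jumps;
    [walk o i] is the index of its position at time [t_{-i}]. *)
Definition walk (l : nat) (o : {ffun 'I_l -> Bset}) (i : nat) : index :=
  n0 + \sum_(j < l | (j < i)%N) dir (o j).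
Definition walk_prob xi (l : nat) (o : {ffun 'I_l -> Bset}) : R :=
  \prod_(i < l) jump xi (walk o i) (- i%:Z) (o i).
Definition walk_expectation xi (l : nat) (X : {ffun 'I_l -> Bset} -> R) : R :=
  \sum_(o : {ffun 'I_l -> Bset}) walk_prob xi o * X o.

Definition compactly_supported (f : phase_space R d -> R) : Prop :=
  compact (closure [set z | f z != 0]).

(** [mu] is the measure [mu^l_delta(xi)]. *)
Definition occupation_measure xi (l : nat) (mu : probability (Borel_phase R d) R) : Prop :=
  forall f : phase_space R d -> R, continuous f -> compactly_supported f ->
    (\int[mu]_z (f z)%:E)%E =
    (walk_expectation xi (fun o : {ffun 'I_l -> Bset} =>
      (tg l)^-1 * \sum_(i < l)
        f (phase_pt (walk o i) (- i%:Z) (xi (walk o i) (- i%:Z))) * tau))%:E.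

Definition weak_cvg (mus : nat -> probability (Borel_phase R d) R)
    (mu : probability (Borel_phase R d) R) : Prop :=
  forall f : phase_space R d -> R, continuous f -> bounded_fun f ->
    (\int[mus n]_z (f z)%:E)%E @[n --> \oo] --> (\int[mu]_z (f z)%:E)%E.

Definition Pdelta : set (probability (Borel_phase R d) R) := [set mu |
  exists2 xi, admissible xi &
  exists (mus : nat -> probability (Borel_phase R d) R) (s : nat -> nat),
    [/\ (forall l, (0 < l)%N -> occupation_measure xi l (mus l)),
        (forall i j, (i < j)%N -> (s i < s j)%N)
      & weak_cvg (mus \o s) mu]].

Definition action (c : 'rV[R]_d) (mu : probability (Borel_phase R d) R) : \bar R :=
  (\int[mu]_z (Lc L c (of_torus z.1.1) (of_circle z.1.2 - tau) z.2)%:E)%E.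

Definition minimizer (c : 'rV[R]_d) (mu : probability (Borel_phase R d) R) : Prop :=
  Pdelta mu /\ forall nu, Pdelta nu -> (action c mu <= action c nu)%E.

Definition msupport (mu : probability (Borel_phase R d) R) : set (phase_space R d) :=
  [set z | forall U : set (phase_space R d), open U -> U z -> (0 < mu U)%E].

Definition Mather_set (c : 'rV[R]_d) : set (phase_space R d) :=
  \bigcup_(mu in minimizer c) msupport mu.

(** [m], [k] index the point [(x_m, t_{k+1})]. *)
Definition Aubry_set (c : 'rV[R]_d) : set (phase_space R d) :=
  \bigcap_(v in cell_solution c)
    [set z | exists m k, pr_tgrid m (k + 1) /\
      z = phase_pt m (k + 1) (Ham_p L (xg m) (tg k) (c + Dx (v^~ k) m))].

Definition control_box : set (phase_space R d) :=
  [set z | exists m k (zeta : 'rV[R]_d), [/\ pr_tgrid m k,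
    (forall j, - (d%:R * lam)^-1 <= zeta 0 j <= (d%:R * lam)^-1)
    & z = phase_pt m k zeta]].

End Scheme.

(* Main.v *)
Require Import Defs.
From HB Require Import structures.
From mathcomp Require Import all_boot all_order all_algebra.
From mathcomp Require Import all_classical all_reals all_analysis.
From mathcomp Require Import measurable_realfun.
From mathcomp Require Import ring lra zify.

(** Let [v] be a time-periodic solution of the discrete cell equation and let
    the walk be driven by an arbitrary control.  The Fenchel inequality between
    the Lagrangian and the Hamiltonian says that, at each step, the mean of [v]
    over the next positions equals the value of [v] at the present one, minus
    the cost of the step, minus [tau * effective_H], plus [tau] times a
    nonnegative [gap]; the gap vanishes exactly when the control is the
    gradient [Ham_p] computed from [v] ([cell_control], [gap_eq0]).  Summing
    along the walk, the values of [v] telescope, and since [v] is bounded the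
    average cost is [- effective_H] plus the average gap up to an error of
    order one over the length of the walk ([walk_cost_identity]).  So every
    admissible limit measure has action at least [- effective_H], and a
    measure of action [- effective_H] has zero mean gap: it lives on the points
    over which the control is the one given by [v].  As [v] is arbitrary, its
    support lies in the intersection defining the Aubry set.  The control given
    by [v] itself has zero gap, hence attains the bound ([optimal_measure]).

    The measures can be handled as finite objects.  For a fixed control all the
    occupation measures are carried by the same finite set of phase points, one
    for each point of the space-time torus grid, and are described by weights
    in a compact simplex.  Along a subsequence the weights converge, and a
    cutoff function equal to one on these points shows that no mass escapes in
    the weak limit, which is therefore given by the limit weights even against
    the unbounded cost ([occupation_limit]).  A continuous function that equals
    one exactly on a prescribed finite set, together with the fact that its
    integral is one, confines the support ([msupport_cutoff]).

    There remains the existence of [v], without which the intersection would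
    be everything.  It is equivalent to a fixed point, up to constants, of the
    evolution over one time period ([effective_HP]).  Since the Hamiltonian is
    convex, the difference of two evolutions is a subsolution of a Markov chain
    whose jump probabilities are bounded below by a positive constant, thanks
    to the strict inequality between [lam] and [lam1] ([phi_diff_step]).  After
    enough periods this chain joins any two odd points of the torus, so the oscillation of
    the difference contracts ([osc_contraction]); the normalized iterates of
    the zero datum then converge geometrically to the fixed point.

    The differentiability of the Hamiltonian, with gradient the unique
    maximizer of its defining supremum, comes from the strict convexity and the
    superlinear growth of the Lagrangian ([legendre_derive]). *)

Set Implicit Arguments.
Unset Strict Implicit.
Unset Printing Implicit Defensive.

Import Order.TTheory GRing.Theory Num.Theory.
Import numFieldNormedType.Exports.

Local Open Scope classical_set_scope.
Local Open Scope ring_scope.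

(** * Directional derivatives *)

Section DirectionalDerivatives.
Context (R : realType) (V : normedModType R).
Implicit Types (f : V -> R) (v w x : V).

Lemma is_derive_line f v x (s : R) :
  (forall y, derivable f y v) ->
  is_derive s 1 (fun u : R => f (u *: v + x)) ('D_v f (s *: v + x)).
Proof.
move=> df.
have E : (fun u : R => u^-1 *: (((fun u => f (u *: v + x)) \o shift s) (u *: (1 : R))
     - f (s *: v + x))) =
  (fun u : R => u^-1 *: ((f \o shift (s *: v + x)) (u *: v) - f (s *: v + x))).
  apply/funext => u /=; congr (_ *: (f _ - _)).
  by rewrite [u%:A]mulr1 scalerDl addrA.
split; first by rewrite /derivable E; exact: df.
by rewrite /derive E.
Qed.

Lemma continuous_line f v x : (forall y, derivable f y v) ->
  continuous (fun u : R => f (u *: v + x)).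
Proof.
move=> df s; apply: differentiable_continuous; apply/derivable1_diffP.
exact: (@ex_derive _ _ _ _ _ _ _ (is_derive_line x s df)).
Qed.

Lemma MVT_line f v x (s : R) : (forall y, derivable f y v) ->
  exists2 u : R, `|u| <= `|s| & f (s *: v + x) - f x = s * 'D_v f (u *: v + x).
Proof.
move=> df.
have ctn a b : {within `[a, b], continuous (fun u : R => f (u *: v + x))}.
  exact/continuous_subspaceT/continuous_line.
have [s0|s0] := leP 0 s.
  have [] := MVT_segment s0 (fun u _ => is_derive_line x u df) (ctn _ _).
  move=> u; rewrite in_itv /= => /andP[u0 us].
  rewrite scale0r add0r subr0 => ->; exists u; last by rewrite mulrC.
  by rewrite !ger0_norm.
have [] := MVT_segment (ltW s0) (fun u _ => is_derive_line x u df) (ctn _ _).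
move=> u; rewrite in_itv /= => /andP[us u0].
rewrite scale0r add0r sub0r => e; exists u; last by rewrite mulrC; lra.
by rewrite !ler0_norm ?lerN2 // ltW.
Qed.

(** Moving first along [v] and then along [w], the mean value theorem turns the
    second increment into [h] times a value of the continuous ['D_w f]. *)
Lemma derive_add f v w x : (forall u y, derivable f y u) ->
  {for x, continuous ('D_w f)} -> 'D_(v + w) f x = 'D_v f x + 'D_w f x.
Proof.
move=> df cw.
rewrite [RHS]addrC; apply/eqP; rewrite -subr_eq; apply/eqP.
pose q u (h : R) : R := h^-1 *: ((f \o shift x) (h *: u) - f x).
have cq u : q u h @[h --> 0^'] --> 'D_u f x by exact: df.
have c1 : (q (v + w) h - q v h) @[h --> 0^'] --> 'D_(v + w) f x - 'D_v f x.
  by apply: cvgB; exact: cq.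
suff c2 : (q (v + w) h - q v h) @[h --> 0^'] --> 'D_w f x.
  by rewrite -(cvg_lim (@Rhausdorff R) c1) -(cvg_lim (@Rhausdorff R) c2).
apply/cvgrPdist_le => /= e e0.
move/cvgrPdist_le: cw => /(_ e e0) /nbhs_ballP [d /= d0 dB].
pose M := `|v| + `|w| + 1.
have M0 : 0 < M by rewrite ltr_wpDl // addr_ge0.
near=> h.
have hn0 : h != 0 by near: h; exact: nbhs_dnbhs_neq.
have hd : `|h| * M < d.
  rewrite -ltr_pdivlMr //; near: h; apply: dnbhs0_lt.
  by rewrite divr_gt0.
have [u uh E] := @MVT_line f w (h *: v + x) h (df w).
have -> : q (v + w) h - q v h = 'D_w f (u *: w + (h *: v + x)).
  rewrite /q -scalerBr /=.
  set A := f _; set B := f x; set C := f (_ *: v + x).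
  have -> : A - B - (C - B) = A - C by ring.
  have AE : A = f (h *: w + (h *: v + x)).
    by rewrite /A scalerDr addrA [_ *: w + _]addrC.
  by rewrite AE /C E /= /GRing.scale /= mulKf.
apply: dB; rewrite -ball_normE /= addrA opprD addrCA subrr addr0 normrN.
apply: le_lt_trans hd; rewrite (le_trans (ler_normD _ _)) // !normrZ /M.
rewrite !mulrDr mulr1 addrC.
by rewrite -addrA lerD // (le_trans (ler_wpM2r _ uh)) // lerDl.
Unshelve. all: end_near. Qed.

Lemma derive_scale f v x (a : R) : derivable f x v ->
  'D_(a *: v) f x = a * 'D_v f x.
Proof.
have [->|a0] := eqVneq a 0; first by rewrite scale0r derive0 mul0r.
move=> df.
pose g (u : R) := f (u *: v + x).
have g1 : derivable g 0 1 by have := (derivable1P f x v).1 df.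
have g1E : 'D_1 g 0 = 'D_v f x.
  rewrite /derive; set q1 := fun h : R => _; set q2 := fun h : R => _.
  suff -> : q1 = q2 by []; apply/funext => u; rewrite /q1 /q2 /=.
  by rewrite /g addr0 scale0r add0r [u%:A]mulr1.
have h1 : is_derive (0 : R) 1 ( *%R a) a.
  by apply: is_derive_eq; rewrite [a%:A]mulr1.
have [dg dgE] : is_derive (0 : R) 1 (g \o ( *%R a)) (a *: 'D_1 g 0).
  have := @is_derive1_comp R g ( *%R a) 0 ('D_1 g 0) a.
  rewrite mulr0 => H.
  have -> : a *: 'D_1 g 0 = 'D_1 g 0 * a by rewrite mulrC.
  by apply: H => //; exact: derivableP.
rewrite -g1E -[RHS]dgE /derive; set q1 := fun h : R => _; set q2 := fun h : R => _.
suff -> : q1 = q2 by []; apply/funext => u; rewrite /q1 /q2 /=.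
by rewrite /g addr0 mulr0 scale0r add0r [u%:A]mulr1 mulrC scalerA.
Qed.

End DirectionalDerivatives.

(** * Strict convexity of the Lagrangian in the velocity *)

Section StrictConvexity.
Context (R : realType).

(** The chords over [0, s] and [s, 1] have slopes [dg a] and [dg b] with
    [a < s < b], and [dg] is increasing. *)
Lemma strict_convex_of_second_derivative (g dg ddg : R -> R) :
  (forall s : R, is_derive s 1 g (dg s)) ->
  (forall s : R, is_derive s 1 dg (ddg s)) ->
  (forall s, 0 < ddg s) ->
  forall s, 0 < s -> s < 1 -> g s < (1 - s) * g 0 + s * g 1.
Proof.
move=> hg hdg ddg0 s s0 s1.
have ctn (k dk : R -> R) a b : (forall s : R, is_derive s 1 k (dk s)) ->
    {within `[a, b], continuous k}.
  move=> hk; apply/continuous_subspaceT => u; apply: differentiable_continuous.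
  exact/derivable1_diffP/(@ex_derive _ _ _ _ _ _ _ (hk u)).
have [a] := MVT s0 (fun u _ => hg u) (ctn _ _ _ _ hg).
rewrite in_itv /= => /andP[a0 as_] ea.
have [b] := MVT s1 (fun u _ => hg u) (ctn _ _ _ _ hg).
rewrite in_itv /= => /andP[sb b1] eb.
have ab : a < b by exact: lt_trans sb.
have [c _ ec] := MVT ab (fun u _ => hdg u) (ctn _ _ _ _ hdg).
have lt_dg : dg a < dg b.
  by rewrite -subr_gt0 ec mulr_gt0 // subr_gt0.
rewrite subr0 in ea.
have -> : (1 - s) * g 0 + s * g 1 =
  g s + s * (1 - s) * (dg b - dg a).
  have -> : g 1 = g s + dg b * (1 - s) by rewrite -eb; ring.
  have -> : g 0 = g s - dg a * s by rewrite -ea; ring.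
  by ring.
by rewrite ltrDl mulr_gt0 ?mulr_gt0 ?subr_gt0.
Qed.

Context (d : nat).
Implicit Types (f : 'rV[R]_d -> R) (x v w p q z : 'rV[R]_d).

Lemma derive_coord f w x :
  (forall v y, derivable f y v) -> (forall v, continuous ('D_v f)) ->
  'D_w f x = \sum_j w 0 j * 'D_(delta_mx 0 j) f x.
Proof.
move=> df cdf; rewrite {1}[w]row_sum_delta.
elim/big_rec2: _ => [|j a v _ <-]; first exact: derive0.
by rewrite derive_add ?derive_scale //; exact: cdf.
Qed.

(** Phrased along a segment from [z] in a nonzero direction [w], the form in
    which the mean value theorem produces it. *)
Definition strictly_convex f := forall z w (s : R), w != 0 -> 0 < s -> s < 1 ->
  f (s *: w + z) < (1 - s) * f z + s * f (w + z).

(** Along a line the second derivative is the quadratic form of the Hessian. *)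
Lemma strictly_convex_hess f :
  (forall v y, derivable f y v) -> (forall v, continuous ('D_v f)) ->
  (forall v w y, derivable ('D_v f) y w) ->
  (forall v w, continuous ('D_w ('D_v f))) ->
  (forall z, posdef (hess f z)) -> strictly_convex f.
Proof.
move=> df cdf ddf cddf pd z w s w0 s0 s1.
pose g (u : R) := f (u *: w + z).
pose dg (u : R) := 'D_w f (u *: w + z).
pose ddg (u : R) := 'D_w ('D_w f) (u *: w + z).
have := @strict_convex_of_second_derivative g dg ddg _ _ _ s s0 s1.
rewrite /g scale0r add0r scale1r; apply => u.
- exact: is_derive_line.
- exact: is_derive_line.
- rewrite /ddg; have := pd (u *: w + z) w w0; congr (0 < _).
  have -> : 'D_w f = \sum_j (fun y => w 0 j * 'D_(delta_mx 0 j) f y).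
    by apply/funext => y; rewrite derive_coord // fct_sumE.
  rewrite derive_sum => [|j]; last by apply: derivableM; [exact: derivable_cst|exact: ddf].
  rewrite !mxE; apply: eq_bigr => j _.
  rewrite deriveMl; last exact: ddf. rewrite !mxE mulrC; congr (_ * _).
  rewrite [RHS]derive_coord; [|exact: ddf|exact: cddf].
  by apply: eq_bigr => i _; rewrite !mxE.
Qed.

Lemma partial_derivable (L : 'rV[R]_d * R * 'rV[R]_d -> R) x t z w :
  derivable L (x, t, z) (0, 0, w) ->
  is_derive z w (fun z => L (x, t, z)) ('D_(0, 0, w) L (x, t, z)).
Proof.
pose q1 (h : R) := h^-1 *: ((L \o shift (x, t, z)) (h *: (0, 0, w)) - L (x, t, z)).
pose q2 (h : R) := h^-1 *:
  (((fun z => L (x, t, z)) \o shift z) (h *: w) - L (x, t, z)).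
have e : q1 = q2.
  apply/funext => h; rewrite /q1 /q2 /=; congr (_ *: (L _ - _)).
  by congr (_, _, _); rewrite /= scaler0 add0r.
by move=> dL; split; rewrite /derivable /derive -/q1 -/q2 -?e.
Qed.

Lemma continuous_partial (L : 'rV[R]_d * R * 'rV[R]_d -> R) x t :
  continuous L -> continuous (fun z => L (x, t, z)).
Proof.
move=> cL z; apply: (@continuous2_cvg _ _ _ _ (nbhs z) _ (cst (x, t)) id (fun a b => L (a, b))).
- have -> : (fun u : 'rV[R]_d * R * 'rV[R]_d => L (u.1, u.2)) = L.
    by apply/funext => -[].
  exact: cL.
- exact: cvg_cst.
- exact: cvg_id.
Qed.

Lemma Lagrangian_strictly_convex (L : 'rV[R]_d * R * 'rV[R]_d -> R) x t :
  Lagrangian_hyps L -> strictly_convex (fun z => L (x, t, z)).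
Proof.
move=> hL.
have [cL dL] := L_C2 hL.
have p1 v : 'D_v (fun z => L (x, t, z)) =
    (fun z => 'D_(0, 0, v) L (x, t, z)).
  apply/funext => z; apply: (@derive_val _ _ _ _ _ _ _ (partial_derivable _)).
  by have [+ _] := dL (0, 0, v); apply.
have p2 v w : 'D_w (fun z => 'D_(0, 0, v) L (x, t, z)) =
    (fun z => 'D_(0, 0, w) ('D_(0, 0, v) L) (x, t, z)).
  apply/funext => z.
  apply: (@derive_val _ _ _ _ _ _ _ (partial_derivable (L := 'D_(0, 0, v) L) _)).
  by have [_ [_ /(_ (0, 0, w)) [+ _]]] := dL (0, 0, v); apply.
apply: strictly_convex_hess.
- move=> v y; apply: (@ex_derive _ _ _ _ _ _ _ (partial_derivable _)).
  by have [+ _] := dL (0, 0, v); apply.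
- move=> v; rewrite p1; apply: (continuous_partial (L := 'D_(0, 0, v) L)).
  by have [_ []] := dL (0, 0, v).
- move=> v w y; rewrite p1.
  apply: (@ex_derive _ _ _ _ _ _ _ (partial_derivable (L := 'D_(0, 0, v) L) _)).
  by have [_ [_ /(_ (0, 0, w)) [+ _]]] := dL (0, 0, v); apply.
- move=> v w; rewrite p1 p2.
  apply: (continuous_partial (L := 'D_(0, 0, w) ('D_(0, 0, v) L))).
  by have [_ [_ /(_ (0, 0, w)) [_ []]]] := dL (0, 0, v).
- by move=> z; exact: (L_convex hL).
Qed.

End StrictConvexity.

(** * Legendre transform *)

Section DotProduct.
Context (R : realType) (d : nat).
Implicit Types (u v w : 'rV[R]_d).

Lemma dotpC u v : dotp u v = dotp v u.
Proof. by apply: eq_bigr => j _; rewrite mulrC. Qed.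

Lemma dotpDl u v w : dotp (u + v) w = dotp u w + dotp v w.
Proof. by rewrite -big_split; apply: eq_bigr => j _; rewrite !mxE mulrDl. Qed.

Lemma dotpZl (a : R) u v : dotp (a *: u) v = a * dotp u v.
Proof. by rewrite mulr_sumr; apply: eq_bigr => j _; rewrite !mxE mulrA. Qed.

Lemma dotpNl u v : dotp (- u) v = - dotp u v.
Proof. by rewrite -scaleN1r dotpZl mulN1r. Qed.

Lemma dotp0l u : dotp 0 u = 0.
Proof. by rewrite -(scale0r 0) dotpZl mul0r. Qed.

Lemma dotpBl u v w : dotp (u - v) w = dotp u w - dotp v w.
Proof. by rewrite dotpDl dotpNl. Qed.

Lemma dotpDr u v w : dotp u (v + w) = dotp u v + dotp u w.
Proof. by rewrite dotpC dotpDl !(dotpC u). Qed.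

Lemma dotpZr (a : R) u v : dotp u (a *: v) = a * dotp u v.
Proof. by rewrite dotpC dotpZl dotpC. Qed.

Lemma dotpBr u v w : dotp u (v - w) = dotp u v - dotp u w.
Proof. by rewrite dotpC dotpBl !(dotpC u). Qed.

Lemma dotp_delta u (j : 'I_d) : dotp (delta_mx 0 j) u = u 0 j.
Proof.
rewrite /dotp (bigD1 j) //= big1 => [|i ij]; rewrite !mxE ?eqxx ?mul1r ?addr0 //.
by rewrite (negbTE ij) mul0r.
Qed.

Lemma ler_norm_coord u j : `|u 0 j| <= `|u|.
Proof.
rewrite [leRHS]/Num.norm /= mx_normrE.
exact: (le_bigmax _ (fun i : 'I_1 * 'I_d => `|u i.1 i.2|) (0, j)).
Qed.

Lemma norm_row_le u (a : R) : 0 <= a -> (forall j, `|u 0 j| <= a) -> `|u| <= a.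
Proof.
move=> a0 ua; rewrite [leLHS]/Num.norm /= mx_normrE.
by apply: bigmax_le => // -[i j] _ /=; rewrite ord1.
Qed.

Lemma norm_dotp u v : `|dotp u v| <= d%:R * (`|u| * `|v|).
Proof.
rewrite (le_trans (ler_norm_sum _ _ _)) //.
rewrite -[d in d%:R]card_ord mulr_natl -sumr_const.
by apply: ler_sum => j _; rewrite normrM ler_pM // ler_norm_coord.
Qed.

Lemma norm_le_enorm u : `|u| <= enorm u.
Proof.
apply: norm_row_le => [|j]; first exact: sqrtr_ge0.
rewrite -sqrtr_sqr ler_wsqrtr // (bigD1 j) //= lerDl.
by apply: sumr_ge0 => i _; rewrite sqr_ge0.
Qed.

Lemma continuous_dotp u : continuous (dotp u).
Proof.
move=> x; apply/(@cvgrPdist_lt _ _ _ (nbhs x) _) => /= e e0.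
pose M := d%:R * `|u| + 1.
have M0 : 0 < M by rewrite ltr_wpDl // mulr_ge0.
near=> y.
have : `|x - y| < e / M by near: y; apply: cvgr_dist_lt; rewrite ?divr_gt0.
rewrite ltr_pdivlMr // => xy.
rewrite -dotpBr (le_lt_trans (norm_dotp _ _)) // mulrA (le_lt_trans _ xy) //.
by rewrite mulrC ler_wpM2l // /M lerDl.
Unshelve. all: end_near. Qed.

End DotProduct.

Section Legendre.
Context (R : realType) (d : nat).
Variable f : 'rV[R]_d -> R.
Hypothesis f_cont : continuous f.
Hypothesis f_sc : strictly_convex f.
Hypothesis f_superlinear : forall a : R, 0 <= a -> exists b : R,
  forall z, a * enorm z + b <= f z.
Implicit Types p q z : 'rV[R]_d.

Definition legendre p : R := sup (range (fun z => dotp p z - f z)).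

Let F p z : R := dotp p z - f z.

Let F_cont p : continuous (F p).
Proof. by move=> z; apply: (@cvgB _ _ _ (nbhs z)); [exact: continuous_dotp|exact: f_cont]. Qed.

Let F_upper p : exists b : R, forall z, F p z <= b - `|z|.
Proof.
have [|b hb] := f_superlinear (a := d%:R * `|p| + 1).
  by rewrite addr_ge0 ?mulr_ge0.
exists (- b) => z; rewrite /F.
have /ler_normlW h1 := norm_dotp p z.
have h2 := hb z.
have h3 : (d%:R * `|p| + 1) * `|z| <= (d%:R * `|p| + 1) * enorm z.
  by rewrite ler_wpM2l ?norm_le_enorm // addr_ge0 ?mulr_ge0.
rewrite mulrDl mul1r mulrA in h1 h3 *; lra.
Qed.

(** Superlinear growth confines the supremum to a ball, where it is attained. *)
Lemma legendre_attained p : exists z, forall z', F p z' <= F p z.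
Proof.
have [b hb] := F_upper p.
pose M := `|b| + `|f 0|.
pose B := [set z : 'rV[R]_d | `|z| <= M].
have cB : compact B.
  apply: bounded_closed_compact.
    exists M; split; first exact: num_real.
    by move=> y My z /= zM; rewrite (le_trans zM) // ltW.
  apply: (@closed_comp _ _ (fun z : 'rV[R]_d => `|z|) [set x | x <= M]).
    by move=> z _; exact: norm_continuous.
  exact: closed_le.
have B0 : B 0 by rewrite /B /= normr0 addr_ge0.
have F0 : F p 0 = - f 0.
  by rewrite /F dotpC dotp0l sub0r.
have [|z zB hz] := EVT_max_rV (ex_intro _ 0 B0) cB (f := F p).
  exact/continuous_subspaceT/F_cont.
exists z => z'; have [zM|zM] := leP `|z'| M; first by apply: hz; rewrite inE.
apply: (@le_trans _ _ (F p 0)); last by apply: hz; rewrite inE.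
rewrite F0 (le_trans (hb z')) //.
move: zM (ler_norm b) (ler_norm (f 0)); rewrite /M; lra.
Qed.

Definition argmax p : 'rV[R]_d := projT1 (cid (legendre_attained p)).

Lemma argmaxP p z : dotp p z - f z <= dotp p (argmax p) - f (argmax p).
Proof. exact: (projT2 (cid (legendre_attained p))). Qed.

Lemma legendreE p : legendre p = dotp p (argmax p) - f (argmax p).
Proof.
apply/eqP; rewrite eq_le; apply/andP; split.
  apply: ge_sup; first by exists (F p 0), 0.
  by move=> _ [z _ <-]; exact: argmaxP.
apply: sup_upper_bound; last by exists (argmax p).
split; first by exists (F p 0), 0.
by exists (F p (argmax p)) => _ [z _ <-]; exact: argmaxP.
Qed.

Lemma fenchel p z : dotp p z - f z <= legendre p.
Proof. by rewrite legendreE argmaxP. Qed.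

Let F_concave p z w (s : R) : w != 0 -> 0 < s -> s < 1 ->
  (1 - s) * F p z + s * F p (w + z) < F p (s *: w + z).
Proof.
move=> w0 s0 s1; have := f_sc z w0 s0 s1.
rewrite /F !dotpDr dotpZr; lra.
Qed.

(** On the sphere of radius [e] around the maximizer at [p], the objective is
    below its maximum by a margin, which survives a small change of [p]; by
    concavity no maximizer can then lie outside of the ball. *)
Lemma argmax_continuous p (e : R) : 0 < e ->
  exists2 del : R, 0 < del &
    forall q, `|q - p| < del -> `|argmax q - argmax p| <= e.
Proof.
move=> e0; set zp := argmax p.
pose S := [set z : 'rV[R]_d | `|z - zp| = e].
have cS : compact S.
  apply: bounded_closed_compact.
    exists (`|zp| + e); split; first exact: num_real.
    move=> y My z /= zS; rewrite (le_trans _ (ltW My)) //.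
    by rewrite -(subrK zp z) (le_trans (ler_normD _ _)) // zS addrC.
  apply: (@closed_comp _ _ (fun z : 'rV[R]_d => `|z - zp|) [set x | x = e]).
    move=> z _; apply: (@cvg_norm _ _ _ (nbhs z) _ (fun z => z - zp)).
    by apply: (@cvgB _ _ _ (nbhs z)); [exact: cvg_id|exact: cvg_cst].
  exact: closed_eq.
have [eta eta0 hS] : exists2 eta : R, 0 < eta &
    forall z, S z -> F p z <= F p zp - eta.
  have [S0|S0] := pselect (S !=set0); last first.
    by exists 1 => // z Sz; exfalso; apply: S0; exists z.
  have [|z1 z1S hz1] := EVT_max_rV S0 cS (f := F p).
    exact/continuous_subspaceT/F_cont.
  rewrite inE in z1S.
  exists (F p zp - F p z1); last first.
    by move=> z Sz; rewrite opprB addrC subrK hz1 // inE.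
  rewrite subr_gt0.
  have w0 : z1 - zp != 0 by rewrite -normr_gt0 z1S.
  have h0 : (0 : R) < 2^-1 by rewrite invr_gt0.
  have h1 : (2^-1 : R) < 1 by rewrite invf_lt1 // ltr1n.
  have := F_concave p zp w0 h0 h1; rewrite subrK.
  have := argmaxP p (2^-1 *: (z1 - zp) + zp); rewrite -/zp -!/(F p _); lra.
(* The norms are maximum norms, whence the factor [d]. *)
pose del := eta / (d%:R * e + 1).
have de0 : 0 < d%:R * e + 1 by rewrite ltr_wpDl // mulr_ge0 // ltW.
exists del; first by rewrite divr_gt0.
move=> q qp; rewrite leNgt; apply/negP => he.
set zq := argmax q in he.
set w := zq - zp in he.
have w0 : w != 0 by rewrite -normr_gt0 (lt_trans e0).
pose s := e / `|w|.
have s0 : 0 < s by rewrite divr_gt0 // (lt_trans e0).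
have s1 : s < 1 by rewrite ltr_pdivrMr ?mul1r // (lt_trans e0).
have Sw : S (s *: w + zp).
  rewrite /S /= addrK normrZ gtr0_norm // /s divfK //.
  by rewrite gt_eqF // (lt_trans e0).
have h1 := F_concave q zp w0 s0 s1.
have h2 : F q zp <= F q (w + zp) by rewrite subrK; exact: argmaxP.
have h3 : F q (s *: w + zp) < F q zp.
  have h4 := hS _ Sw.
  have h5 : dotp (q - p) (s *: w) < eta.
    rewrite (le_lt_trans (ler_norm _)) // (le_lt_trans (norm_dotp _ _)) //.
    move: Sw; rewrite /S /= addrK => ->.
    rewrite mulrCA; move: qp; rewrite ltr_pdivlMr // => /(le_lt_trans _); apply.
    by rewrite ler_wpM2l // lerDl.
  move: h4 h5; rewrite /F dotpBl !dotpDr; lra.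
have h6 : s * F q zp <= s * F q (w + zp) by rewrite ler_wpM2l // ltW.
lra.
Qed.

(** The difference quotient of the supremum in a coordinate direction lies
    between the corresponding coordinates of the maximizers at both ends, and
    the maximizer depends continuously on the point. *)
Lemma legendre_derive p j :
  is_derive p (delta_mx 0 j) legendre (argmax p 0 j).
Proof.
have c : h^-1 *: ((legendre \o shift p) (h *: delta_mx 0 j) - legendre p)
    @[h --> 0^'] --> argmax p 0 j.
  apply/cvgrPdist_le => /= e e0.
  have [del del0 hdel] := argmax_continuous p e0.
  near=> h.
  have h0 : h != 0 by near: h; exact: nbhs_dnbhs_neq.
  pose q := h *: delta_mx 0 j + p.
  have qp : `|q - p| < del.
    rewrite /q addrK normrZ.
    apply: (@le_lt_trans _ _ (`|h|)); last by near: h; exact: dnbhs0_lt.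
    rewrite ler_piMr //; apply: norm_row_le => // i.
    by rewrite mxE eqxx /=; case: (i == j); rewrite ?normr1 ?normr0.
  have hq : `|argmax q 0 j - argmax p 0 j| <= e.
    have := hdel _ qp; apply: le_trans.
    by have := ler_norm_coord (argmax q - argmax p) j; rewrite !mxE.
  have lo : h * argmax p 0 j <= legendre q - legendre p.
    have := fenchel q (argmax p); rewrite (legendreE p) /q.
    rewrite dotpDl dotpZl dotp_delta; lra.
  have hi : legendre q - legendre p <= h * argmax q 0 j.
    have := fenchel p (argmax q); rewrite (legendreE q) {1 4}/q.
    rewrite dotpDl dotpZl dotp_delta; lra.
  rewrite /= -/q distrC (le_trans _ hq) //.
  set D := legendre q - legendre p in lo hi *.
  have -> : h^-1 *: D - argmax p 0 j = h^-1 * (D - h * argmax p 0 j).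
    by rewrite mulrBr mulKf.
  rewrite normrM normfV ler_pdivrMl ?normr_gt0 // -normrM.
  rewrite !ger0_norm; [|rewrite mulrBr; lra|lra].
  rewrite mulrBr; lra.
split; first by apply/cvg_ex; exists (argmax p 0 j).
by apply: cvg_lim c.
Unshelve. all: end_near. Qed.

Lemma grad_legendre p : grad legendre p = argmax p.
Proof.
apply/rowP => j; rewrite mxE.
exact: (@derive_val _ _ _ _ _ _ _ (legendre_derive p j)).
Qed.

Lemma legendre_subgradient p q :
  legendre p + dotp (grad legendre p) (q - p) <= legendre q.
Proof.
have := fenchel q (argmax p); rewrite (legendreE p) grad_legendre.
rewrite dotpBr ![dotp (argmax p) _]dotpC; lra.
Qed.

Lemma fenchel_grad p :
  dotp p (grad legendre p) - f (grad legendre p) = legendre p.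
Proof. by rewrite grad_legendre legendreE. Qed.

(** Two distinct maximizers would be beaten by their midpoint. *)
Lemma fenchel_eq p z : dotp p z - f z = legendre p -> z = grad legendre p.
Proof.
move=> e; rewrite grad_legendre; apply/eqP.
rewrite -subr_eq0; apply/negPn/negP => w0.
have h0 : (0 : R) < 2^-1 by rewrite invr_gt0.
have h1 : (2^-1 : R) < 1 by rewrite invf_lt1 // ltr1n.
have := F_concave p (argmax p) w0 h0 h1; rewrite subrK.
have := argmaxP p (2^-1 *: (z - argmax p) + argmax p).
rewrite -!/(F p _); move: e; rewrite legendreE -!/(F p _) => ->; lra.
Qed.

End Legendre.

(** * Parity and periodicity on the grid *)

Section GridCombinatorics.
Context (d : nat).
Implicit Types (m n : 'rV[int]_d) (k : int) (o : Bset d).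

Lemma dvd2zD (a b : int) : (2 %| a + b)%Z = ((2 %| a)%Z == (2 %| b)%Z).
Proof. lia. Qed.

Definition coord_sum m : int := \sum_j m 0 j.

Lemma coord_sumD m n : coord_sum (m + n) = coord_sum m + coord_sum n.
Proof. by rewrite -big_split; apply: eq_bigr => j _; rewrite mxE. Qed.

Lemma coord_sumZ (a : int) n : coord_sum (a *: n) = a * coord_sum n.
Proof. by rewrite mulr_sumr; apply: eq_bigr => j _; rewrite mxE. Qed.

Lemma coord_sum_ei (j : 'I_d) : coord_sum (ei j) = 1.
Proof.
rewrite /coord_sum (bigD1 j) //= big1 => [|i ij]; rewrite mxE ?eqxx ?addr0 //=.
by rewrite (negbTE ij).
Qed.

Lemma ievenxD m n : ievenx (m + n) = (ievenx m == ievenx n).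
Proof. by rewrite /ievenx -/(coord_sum _) coord_sumD dvd2zD. Qed.

Lemma ievenx_dir o : ievenx (dir o) = false.
Proof.
rewrite /ievenx -/(coord_sum _) coord_sumZ coord_sum_ei mulr1.
by case: o.2; rewrite ?expr1 ?expr0; lia.
Qed.

Lemma ievenx_double (N : nat) n : ievenx ((N.*2)%:Z *: n).
Proof. by rewrite /ievenx -/(coord_sum _) coord_sumZ; lia. Qed.

Lemma ievent_double (K : nat) k : ievent ((K.*2)%:Z * k).
Proof. rewrite /ievent; lia. Qed.

Lemma ieventD k k' : ievent (k + k') = (ievent k == ievent k').
Proof. exact: dvd2zD. Qed.

Lemma tgrid_even m k : ievent k -> tgrid m k = ~~ ievenx m.
Proof. by rewrite /tgrid => ->; case: ievenx. Qed.

Lemma tgrid0 m : tgrid m 0 = ~~ ievenx m.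
Proof. by apply: tgrid_even; rewrite /ievent; lia. Qed.

Lemma tgrid_step m k : tgrid m (k + 1) = grid m k.
Proof.
have E1 : ievent 1 = false by rewrite /ievent; lia.
by rewrite /tgrid /grid ieventD E1; do 2!case: (_ %| _)%Z => //=;
  case: ievenx; case: ievent.
Qed.

Lemma tgridS m (k : nat) : tgrid m k.+1 = grid m k.
Proof. by rewrite intS addrC tgrid_step. Qed.

Lemma tgrid_dir m k o : tgrid (m + dir o) k = grid m k.
Proof.
by rewrite /tgrid /grid ievenxD ievenx_dir; case: ievenx; case: ievent.
Qed.

Lemma tgrid_shift (N K : nat) m n k z :
  tgrid (m + (N.*2)%:Z *: n) (k + (K.*2)%:Z * z) = tgrid m k.
Proof.
rewrite /tgrid ievenxD ievenx_double ieventD ievent_double.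
by case: ievenx; case: ievent.
Qed.

Lemma dir_false (j : 'I_d) : dir (j, false) = ei j.
Proof. by rewrite /dir /= expr0 scale1r. Qed.

Lemma dir_true (j : 'I_d) : dir (j, true) = - ei j.
Proof. by rewrite /dir /= expr1 scaleN1r. Qed.

Definition opp_dir o : Bset d := (o.1, ~~ o.2).

Lemma dirN o : dir (opp_dir o) = - dir o.
Proof. by case: o => j [] /=; rewrite ?dir_false ?dir_true ?opprK. Qed.

Lemma big_Bset (T : nmodType) (F : Bset d -> T) :
  \sum_o F o = \sum_j (F (j, false) + F (j, true)).
Proof.
rewrite (eq_bigr (fun o => F (o.1, o.2))) => [|[]//].
rewrite -(pair_bigA _ (fun j b => F (j, b))) /=.
by apply: eq_bigr => j _; rewrite big_bool addrC.
Qed.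

Lemma row_ei_sum m : m = \sum_j m 0 j *: ei j.
Proof. exact: row_sum_delta. Qed.

(** [periodic_on_tgrid] speaks of one period in one direction at a time; as all
    periods are even they preserve the grid, so these steps can be composed. *)
Lemma lattice_periodic (T : Type) (N K : nat) (v : 'rV[int]_d -> int -> T) :
  periodic_on_tgrid N K v -> forall m k n z, tgrid m k ->
  v (m + (N.*2)%:Z *: n) (k + (K.*2)%:Z * z) = v m k.
Proof.
move=> pv.
have tS m k n : tgrid (m + (N.*2)%:Z *: n) k = tgrid m k.
  by have := tgrid_shift N 0 m n k 0; rewrite mulr0 addr0.
have tT m k z : tgrid m (k + (K.*2)%:Z * z) = tgrid m k.
  by have := tgrid_shift 0 K m 0 k z; rewrite scaler0 addr0.
pose Q n := forall m k, tgrid m k -> v (m + (N.*2)%:Z *: n) k = v m k.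
have QD n n' : Q n -> Q n' -> Q (n + n').
  by move=> Qn Qn' m k tm; rewrite scalerDr addrA Qn' ?tS // Qn.
have QN n : Q n -> Q (- n).
  by move=> Qn m k tm; rewrite -[LHS]Qn ?tS // -addrA -scalerDr addNr scaler0 addr0.
have Q0 : Q 0 by move=> m k _; rewrite scaler0 addr0.
have Qe j : Q (ei j) by move=> m k tm; rewrite (pv _ _ tm).1.
have Qn (j : 'I_d) (a : nat) : Q (a%:Z *: ei j).
  elim: a => [|a IH]; first by rewrite scale0r.
  by rewrite intS scalerDl scale1r; apply: QD.
have QZ (j : 'I_d) (a : int) : Q (a *: ei j).
  case: a => a; first exact: Qn.
  by rewrite NegzE scaleNr; apply/QN/Qn.
have Qall n : Q n by rewrite (row_ei_sum n); elim/big_ind: _ => // *; exact: QZ.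
pose S z := forall m k, tgrid m k -> v m (k + (K.*2)%:Z * z) = v m k.
have S1 (a : nat) : S a%:Z.
  elim: a => [|a IH] m k tm; first by rewrite mulr0 addr0.
  by rewrite intS mulrDr mulr1 addrA addrAC (pv _ _ _).2 ?tT ?IH //. 
have SZ z : S z.
  case: z => a; first exact: S1.
  move=> m k tm; rewrite NegzE -[LHS](S1 a.+1) ?tT //.
  by rewrite -addrA -mulrDr addNr mulr0 addr0.
by move=> m k n z tm; rewrite Qall ?tT // SZ.
Qed.

(** Integer division, with the remainder as a natural number: the scheme is
    indexed by natural times. *)
Lemma int_period (K : nat) k : (0 < K)%N -> exists (a : nat) (z : int),
  (a < K.*2)%N /\ k = a%:Z + (K.*2)%:Z * z.
Proof.
move=> K_gt0; have K2 : (K.*2)%:Z != 0 by lia.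
exists `|(k %% (K.*2)%:Z)%Z|%N, (k %/ (K.*2)%:Z)%Z; split.
  rewrite -ltz_nat gez0_abs ?modz_ge0 // ltz_pmod //; lia.
by rewrite gez0_abs ?modz_ge0 // addrC mulrC -divz_eq.
Qed.

End GridCombinatorics.

(** * The Hamiltonian and the jump probabilities *)

Section HamiltonianFacts.
Context (R : realType) (d : nat).
Variable L : 'rV[R]_d * R * 'rV[R]_d -> R.
Hypothesis hL : Lagrangian_hyps L.
Implicit Types (x p q z : 'rV[R]_d) (t : R).

Let Lsc x t := Lagrangian_strictly_convex x t hL.
Let Lct x t : continuous (fun z => L (x, t, z)) :=
  @continuous_partial R d L x t (proj1 (L_C2 hL)).
Let Lsl x t : forall a : R, 0 <= a -> exists b : R,
    forall z, a * enorm z + b <= L (x, t, z).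
Proof.
by move=> a a0; have [b hb] := L_superlinear hL a0; exists b => z; exact: hb.
Qed.

Lemma Ham_fenchel x t p z : dotp p z - L (x, t, z) <= Ham L x t p.
Proof. exact: (fenchel (@Lct x t) (@Lsl x t)). Qed.

Lemma Ham_fenchel_p x t p :
  dotp p (Ham_p L x t p) - L (x, t, Ham_p L x t p) = Ham L x t p.
Proof. exact: (fenchel_grad (@Lct x t) (@Lsc x t) (@Lsl x t)). Qed.

Lemma Ham_fenchel_eq x t p z :
  dotp p z - L (x, t, z) = Ham L x t p -> z = Ham_p L x t p.
Proof. exact: (fenchel_eq (@Lct x t) (@Lsc x t) (@Lsl x t)). Qed.

Lemma Ham_subgradient x t p q :
  Ham L x t p + dotp (Ham_p L x t p) (q - p) <= Ham L x t q.
Proof. exact: (legendre_subgradient (@Lct x t) (@Lsc x t) (@Lsl x t)). Qed.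

Lemma L_lattice x t z (n : 'rV[int]_d) (k : int) :
  L (x + map_mx intr n, t + k%:~R, z) = L (x, t, z).
Proof.
have Lx (j : 'I_d) (a : nat) y s : L (y + a%:R *: delta_mx 0 j, s, z) = L (y, s, z).
  elim: a => [|a IH]; first by rewrite scale0r addr0.
  by rewrite mulrSr scalerDl scale1r addrA (L_periodic_x hL).
have LX (j : 'I_d) (a : int) y s :
    L (y + a%:~R *: delta_mx 0 j, s, z) = L (y, s, z).
  case: a => a; first exact: Lx.
  rewrite NegzE mulrNz scaleNr.
  by rewrite -[LHS](Lx j a.+1) -addrA addNr addr0.
have LT (a : nat) y s : L (y, s + a%:R, z) = L (y, s, z).
  elim: a => [|a IH]; first by rewrite addr0.
  by rewrite mulrSr addrA (L_periodic_t hL).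
have -> : L (x + map_mx intr n, t + k%:~R, z) = L (x + map_mx intr n, t, z).
  case: k => a; first exact: LT.
  by rewrite NegzE mulrNz -[LHS](LT a.+1) -addrA addNr addr0.
have -> : map_mx intr n = \sum_j (n 0 j)%:~R *: delta_mx 0 j :> 'rV[R]_d.
  rewrite [LHS]row_sum_delta; apply: eq_bigr => j _.
  by rewrite mxE.
elim/big_rec: _ => [|j y _ IH]; first by rewrite addr0.
by rewrite addrCA addrC LX.
Qed.

Lemma Ham_lattice x t (n : 'rV[int]_d) (k : int) :
  Ham L (x + map_mx intr n) (t + k%:~R) = Ham L x t.
Proof.
apply/funext => p; congr sup.
by apply: eq_imagel => z _; rewrite L_lattice.
Qed.

End HamiltonianFacts.

Section Scheme.
Context (R : realType) (d N K : nat).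
Hypotheses (N_gt0 : (0 < N)%N) (K_gt0 : (0 < K)%N).
Implicit Types (m n : 'rV[int]_d) (k : int) (o : Bset d) (zeta : 'rV[R]_d).

Lemma h_gt0 : 0 < h R N.
Proof. by rewrite invr_gt0 ltr0n double_gt0. Qed.

Lemma tau_gt0 : 0 < tau R K.
Proof. by rewrite invr_gt0 ltr0n double_gt0. Qed.

Lemma lam_gt0 : 0 < lam R N K.
Proof. by rewrite divr_gt0 ?h_gt0 ?tau_gt0. Qed.

Lemma lamhE : lam R N K * h R N = tau R K.
Proof. by rewrite divfK // gt_eqF // h_gt0. Qed.

Lemma tau_period : tau R K * (K.*2)%:R = 1.
Proof. by rewrite mulVf // pnatr_eq0 double_eq0 -lt0n. Qed.

Lemma h_period : h R N * (N.*2)%:R = 1.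
Proof. by rewrite mulVf // pnatr_eq0 double_eq0 -lt0n. Qed.

Lemma xg_shift m n : xg R N (m + (N.*2)%:Z *: n) = xg R N m + map_mx intr n.
Proof.
apply/rowP => j; rewrite !mxE rmorphD rmorphM /= mulrDr mulrA.
by rewrite h_period mul1r.
Qed.

Lemma tg_shift k z : tg R K (k + (K.*2)%:Z * z) = tg R K k + z%:~R.
Proof. by rewrite /tg rmorphD rmorphM /= mulrDr mulrA tau_period mul1r. Qed.

Definition jump_prob zeta o : R :=
  (2 * d%:R)^-1 - lam R N K / 2 * dotp (map_mx intr (dir o)) zeta.

Lemma dotp_dir o zeta :
  dotp (map_mx intr (dir o)) zeta = (-1) ^+ o.2 * zeta 0 o.1.
Proof.
have -> : map_mx intr (dir o) = (-1) ^+ o.2 *: delta_mx 0 o.1 :> 'rV[R]_d.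
  apply/rowP => j; rewrite !mxE rmorphM rmorphXn rmorphN rmorph1 /=.
  by rewrite rmorph_nat.
by rewrite dotpZl dotp_delta.
Qed.

(** The drift of a jump reproduces the discrete gradient. *)
Lemma jump_prob_avg zeta (g : 'rV[int]_d -> R) m :
  \sum_o jump_prob zeta o * g (m + dir o) =
  avg g m - tau R K * dotp (Dx N g m) zeta.
Proof.
rewrite /avg -lamhE.
have -> : dotp (Dx N g m) zeta = \sum_j (g (m + ei j) - g (m - ei j)) /
   (2 * h R N) * zeta 0 j by apply: eq_bigr => j _; rewrite mxE.
rewrite !big_Bset !mulr_sumr -sumrB; apply: eq_bigr => j _.
rewrite /jump_prob !dotp_dir /= expr0 expr1 dir_false dir_true.
have hn0 : h R N != 0 by rewrite gt_eqF // h_gt0.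
by set a := (2 * d%:R)^-1; field; rewrite hn0.
Qed.
End Scheme.

(** * The discrete evolution *)

Section DiscreteEvolution.
Context (R : realType) (d N K : nat).
Hypotheses (d_gt0 : (0 < d)%N) (N_gt0 : (0 < N)%N) (K_gt0 : (0 < K)%N).
Implicit Types (m n a b : 'rV[int]_d) (o : Bset d) (zeta : 'rV[R]_d).
Implicit Types (f g v w : 'rV[int]_d -> R).

Lemma avgD f g m : avg (f \+ g) m = avg f m + avg g m.
Proof. by rewrite /avg -mulrDr -big_split. Qed.

Lemma avgN f m : avg (\- f) m = - avg f m.
Proof. by rewrite /avg -mulrN -sumrN. Qed.

Lemma avg_cst (x : R) m : avg (cst x) m = x.
Proof.
have -> : avg (cst x) m = (2 * d%:R)^-1 * ((d * 2)%:R * x).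
  by congr (_ * _); rewrite sumr_const card_prod card_ord card_bool mulr_natl.
rewrite natrM [d%:R * 2]mulrC mulKf //.
by rewrite mulf_neq0 ?pnatr_eq0 // -lt0n.
Qed.

Lemma DxD f g m : Dx N (f \+ g) m = Dx N f m + Dx N g m.
Proof. by apply/rowP => j; rewrite !mxE -mulrDl opprD addrACA. Qed.

Lemma DxN f m : Dx N (\- f) m = - Dx N f m.
Proof. by apply/rowP => j; rewrite !mxE -mulNr opprB opprK addrC. Qed.

Lemma Dx_cst (x : R) m : Dx N (cst x) m = 0.
Proof. by apply/rowP => j; rewrite !mxE subrr mul0r. Qed.

Lemma jump_prob_sum zeta : \sum_o jump_prob N K zeta o = 1.
Proof.
have := @jump_prob_avg R d N K N_gt0 zeta (cst 1) 0.
rewrite avg_cst Dx_cst dotp0l.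
by rewrite mulr0 subr0 => <-; apply: eq_bigr => o _; rewrite mulr1.
Qed.

Lemma jump_prob_le zeta (x : R) o : (forall j, `|zeta 0 j| <= x) ->
  (2 * d%:R)^-1 - lam R N K / 2 * x <= jump_prob N K zeta o.
Proof.
move=> zx; rewrite /jump_prob lerD2l lerN2 ler_wpM2l //.
  by rewrite divr_ge0 // ltW // lam_gt0.
rewrite dotp_dir (le_trans (ler_norm _)) // normrM normrX normrN1 expr1n mul1r.
exact: zx.
Qed.

Lemma jump_prob_ge0 zeta o :
  (forall j, - (d%:R * lam R N K)^-1 <= zeta 0 j <= (d%:R * lam R N K)^-1) ->
  0 <= jump_prob N K zeta o.
Proof.
move=> zx; apply: (le_trans _ (@jump_prob_le _ (d%:R * lam R N K)^-1 _ _)).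
  have l0 : lam R N K != 0 by rewrite gt_eqF // lam_gt0.
  have d0 : d%:R != 0 :> R by rewrite pnatr_eq0 -lt0n.
  by rewrite subr_ge0 le_eqVlt; apply/orP; left; apply/eqP; field; rewrite l0 d0.
by move=> j; rewrite ler_norml.
Qed.

Variable L : 'rV[R]_d * R * 'rV[R]_d -> R.
Hypothesis hL : Lagrangian_hyps L.
Variable c : 'rV[R]_d.

Local Notation phi := (phi N K L ^~ c).

(** Convexity of the Hamiltonian linearizes the scheme from one side: the
    difference of two solutions is a subsolution of a linear averaging. *)
Lemma phi_diff_step v w (k : nat) m :
  phi v k.+1 m - phi w k.+1 m <=
  \sum_o jump_prob N K (Ham_p L (xg R N m) (tg R K k) (c + Dx N (phi w k) m)) o
    * (phi v k (m + dir o) - phi w k (m + dir o)).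
Proof.
rewrite (jump_prob_avg K N_gt0 _ (phi v k \- phi w k)) /= avgD avgN DxD DxN.
set p := c + Dx N (phi w k) m; set q := c + Dx N (phi v k) m.
have -> : Dx N (phi v k) m - Dx N (phi w k) m = q - p.
  by rewrite /p /q opprD addrACA subrr add0r.
have := Ham_subgradient hL (xg R N m) (tg R K k) p q.
rewrite dotpC => hs.
have := ler_wpM2l (ltW (@tau_gt0 R K K_gt0)) hs.
lra.
Qed.

(** The Hamiltonian has period one in time, which is [K.*2] time steps. *)
Lemma phi_addk v (k l : nat) :
  phi v (K.*2 * l + k)%N = phi (phi v (K.*2 * l)%N) k.
Proof.
elim: k => [|k IH]; first by rewrite addn0.
rewrite addnS /= IH; apply/funext => m.
have -> : tg R K (K.*2 * l + k)%N = tg R K k + (l : int)%:~R.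
  by rewrite PoszD PoszM addrC tg_shift.
by have := Ham_lattice hL (xg R N m) (tg R K k) 0 l; rewrite map_mx0 addr0 => ->.
Qed.

Lemma phi_periodic v k :
  (forall m j, ~~ ievenx m -> v (m + (N.*2)%:Z *: ei j) = v m) ->
  forall m j, tgrid m k%:Z -> phi v k (m + (N.*2)%:Z *: ei j) = phi v k m.
Proof.
move=> pv; elim: k => [|k IH] m j; first by rewrite tgrid0; apply: pv.
rewrite tgridS => gm /=.
have e o : phi v k (m + (N.*2)%:Z *: ei j + dir o) = phi v k (m + dir o).
  by rewrite addrAC IH ?tgrid_dir.
rewrite xg_shift //.
have := Ham_lattice hL (xg R N m) (tg R K k) (ei j) 0; rewrite addr0 => ->.
congr (_ - _ * Ham L _ _ (_ + _)).
  by congr (_ * _); apply: eq_bigr => o _; exact: e.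
apply/rowP => i; rewrite !mxE.
have := e (i, false); have := e (i, true).
by rewrite dir_false dir_true => -> ->.
Qed.

End DiscreteEvolution.

(** * Reachability and geometric limits *)

Section Reachability.
Context (d : nat).
Implicit Types (n m : 'rV[int]_d) (o : Bset d).

Definition reach (k : nat) n : Prop :=
  exists2 s : seq (Bset d), size s = k & n = \sum_(o <- s) dir o.

Lemma reach0 : reach 0 0.
Proof. by exists [::]; rewrite ?big_nil. Qed.

Lemma reachD k l n m : reach k n -> reach l m -> reach (k + l) (n + m).
Proof.
by move=> [s <- ->] [t <- ->]; exists (s ++ t); rewrite ?size_cat ?big_cat.
Qed.

Lemma reach_dir o : reach 1 (dir o).
Proof. by exists [:: o]; rewrite ?big_seq1. Qed.

Lemma reach_scale (j : 'I_d) (b : bool) (a : nat) :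
  reach a (a%:Z *: dir (j, b)).
Proof.
elim: a => [|a IH]; first by rewrite scale0r; exact: reach0.
by rewrite intS scalerDl scale1r -add1n; apply: reachD => //; exact: reach_dir.
Qed.

(** A jump followed by its opposite spends two units of time. *)
Lemma reach_wait (d_gt0 : (0 < d)%N) k l n : reach k n -> reach (k + l.*2) n.
Proof.
move=> kn; elim: l => [|l IH]; first by rewrite addn0.
pose o : Bset d := (Ordinal d_gt0, false).
have -> : n = n + (dir o + dir (opp_dir o)) by rewrite dirN subrr addr0.
have -> : (k + l.+1.*2 = k + l.*2 + (1 + 1))%N by lia.
by apply: reachD => //; apply: reachD; exact: reach_dir.
Qed.

Lemma reach_abs n : reach (\sum_j `|n 0%R j|)%N n.
Proof.
rewrite {2}(row_ei_sum n).
apply: (big_rec2 (fun k m => reach k m)) => [|j k m _ km]; first exact: reach0.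
apply: reachD => //.
case: (n 0 j) => a; first by rewrite -dir_false; exact: reach_scale.
by rewrite NegzE scaleNr -scalerN -dir_true abszN; exact: reach_scale.
Qed.

(** Parity is the only obstruction once there is enough time; the spare time,
    which is even, is spent going back and forth. *)
Lemma reach_large (d_gt0 : (0 < d)%N) k n :
  (\sum_j `|n 0%R j| <= k)%N -> ievenx n -> ~~ odd k -> reach k n.
Proof.
move=> nk en ek.
have eS : ~~ odd (\sum_j `|n 0%R j|)%N.
  suff -> : odd (\sum_j `|n 0%R j|)%N = ~~ (2 %| \sum_j n 0 j)%Z by rewrite negbK.
  apply: (big_rec2 (fun (a : nat) (b : int) => odd a = ~~ (2 %| b)%Z)) => // j a b _ e.
  by rewrite oddD dvd2zD e; case: (n 0 j) => x; lia.
have -> : k = (\sum_j `|n 0%R j| + (k - \sum_j `|n 0%R j|)./2.*2)%N.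
  rewrite even_halfK ?subnKC // oddB //; by case: odd ek eS => //; case: odd.
by apply: reach_wait => //; exact: reach_abs.
Qed.

Variable N : nat.
Hypothesis N_gt0 : (0 < N)%N.

Definition cell_rep (i : {ffun 'I_d -> 'I_(N.*2)}) : 'rV[int]_d :=
  \row_j (i j : nat)%:Z.

Lemma cell_repP m : exists i n, m = cell_rep i + (N.*2)%:Z *: n.
Proof.
have N2 : (0 < N.*2)%N by rewrite double_gt0.
have lt j : (`|(m 0%R j %% (N.*2)%:Z)%Z| < N.*2)%N.
  by rewrite -ltz_nat gez0_abs ?modz_ge0 ?ltz_pmod //; lia.
exists [ffun j => Ordinal (lt j)], (\row_j (m 0%R j %/ (N.*2)%:Z)%Z).
apply/rowP => j; rewrite !mxE ffunE /= gez0_abs ?modz_ge0 //; last by lia.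
by rewrite addrC mulrC -divz_eq.
Qed.

Lemma cell_rep_sum i : (\sum_j `|cell_rep i 0%R j| <= N.*2 * d)%N.
Proof.
rewrite -[d in leqRHS]card_ord mulnC -sum_nat_const.
by apply: leq_sum => j _; rewrite mxE; apply: ltnW; exact: ltn_ord.
Qed.

End Reachability.

Section NestedIntervals.
Context (R : realType).
Implicit Types (x : nat -> R) (C th : R).

Lemma small_geometric C th (e : R) :
  0 <= th -> th < 1 -> 0 < e -> exists n, C * th ^+ n < e.
Proof.
move=> th0 th1 e0.
have : (C * th ^+ n) @[n --> \oo] --> (0 : R).
  have -> : (fun n => C * th ^+ n) = geometric C th by [].
  by apply: cvg_geometric; rewrite ger0_norm.
move/cvgrPdist_lt => /(_ e e0) [n _ /(_ n (leqnn n))] /=.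
by rewrite sub0r normrN => /(le_lt_trans (ler_norm _)) ?; exists n.
Qed.

Lemma le_geometric C th (a b : R) : 0 <= th -> th < 1 ->
  (forall n, a <= b + C * th ^+ n) -> a <= b.
Proof.
move=> th0 th1 ab; apply/ler_addgt0Pr => e e0.
have [n hn] := small_geometric C th0 th1 e0.
by rewrite (le_trans (ab n)) // lerD2l ltW.
Qed.

(** The intervals of radius [C / (1 - th) * th ^+ n] around [x n] decrease with
    [n]; the limit is the supremum of their lower ends. *)
Lemma geometric_limit x C th : 0 <= C -> 0 <= th -> th < 1 ->
  (forall n, `|x n.+1 - x n| <= C * th ^+ n) ->
  exists u, forall n, `|u - x n| <= C / (1 - th) * th ^+ n.
Proof.
move=> C0 th0 th1 hx.
have t1 : 0 < 1 - th by rewrite subr_gt0.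
pose M := C / (1 - th).
have M0 : 0 <= M by rewrite divr_ge0 // ltW.
have step n : M * th ^+ n.+1 = M * th ^+ n - C * th ^+ n.
  by rewrite exprS /M; field; rewrite gt_eqF.
pose lo n := x n - M * th ^+ n; pose hi n := x n + M * th ^+ n.
have lo_inc n : lo n <= lo n.+1.
  rewrite /lo step; have := hx n; rewrite ler_norml => /andP[? _]; lra.
have hi_dec n : hi n.+1 <= hi n.
  rewrite /hi step; have := hx n; rewrite ler_norml => /andP[_ ?]; lra.
have lohi n k : lo n <= hi k.
  have h1 : lo n <= lo (maxn n k).
    by apply: (homo_leq (f := lo) (r := <=%R)) (leq_maxl n k) => // y z t; exact: le_trans.
  have h2 : hi (maxn n k) <= hi k.
    apply: (homo_leq (f := hi) (r := fun a b => b <= a)) (leq_maxr n k) => //.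
    by move=> y z t h ?; apply: le_trans h.
  apply: (le_trans h1); apply: le_trans h2.
  by rewrite /lo /hi lerD2l lerNl -subr_ge0 opprK addr_ge0 // mulr_ge0 ?exprn_ge0.
exists (sup (range lo)) => n.
rewrite ler_norml lerBrDr lerBlDr addrC [X in _ && X]/=; apply/andP; split.
  apply: sup_upper_bound; last by exists n.
  by split; [exists (lo 0%N), 0%N|exists (hi 0%N) => _ [k _ <-]].
rewrite addrC; apply: ge_sup; first by exists (lo 0%N), 0%N.
by move=> _ [k _ <-]; exact: lohi.
Qed.

End NestedIntervals.

(** * Existence of the effective Hamiltonian *)

Section FixedPoint.
Context (R : realType) (d N K : nat).
Hypotheses (d_gt0 : (0 < d)%N) (N_gt0 : (0 < N)%N) (K_gt0 : (0 < K)%N).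
Variables (L : 'rV[R]_d * R * 'rV[R]_d -> R) (r lam1 : R) (c : 'rV[R]_d).
Hypotheses (hL : Lagrangian_hyps L) (r_gt0 : 0 < r) (lam_lt : lam R N K < lam1).
Local Notation phi := (phi N K L ^~ c).
Hypothesis phi_X : forall v, Xset N r v -> Xset N r (phi v K.*2).
Hypothesis Hp_le : forall v, Xset N r v -> forall m (k : nat), grid m k ->
  `|Ham_p L (xg R N m) (tg R K k) (c + Dx N (phi v k) m)| <= (d%:R * lam1)^-1.
Implicit Types (m n a b : 'rV[int]_d) (o : Bset d) (f g v w : 'rV[int]_d -> R).

Let lam1_gt0 : 0 < lam1 := lt_trans (@lam_gt0 R N K N_gt0 K_gt0) lam_lt.
Let dR_gt0 : 0 < d%:R :> R. Proof. by rewrite ltr0n. Qed.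

(** The strict gap between [lam] and [lam1] keeps the jump probabilities of
    [phi_diff_step] above this constant. *)
Let p0 : R := (2 * d%:R)^-1 - lam R N K / 2 * (d%:R * lam1)^-1.

Let p0_gt0 : 0 < p0.
Proof.
have -> : p0 = (2 * d%:R)^-1 * (1 - lam R N K / lam1).
  by rewrite /p0; field; rewrite !gt_eqF.
by rewrite mulr_gt0 ?invr_gt0 ?mulr_gt0 // subr_gt0 ltr_pdivrMr // mul1r.
Qed.

Let p0_le1 : p0 <= 1.
Proof.
rewrite /p0 (@le_trans _ _ (2 * d%:R)^-1) //.
  rewrite lerBlDr lerDl mulr_ge0 ?divr_ge0 ?invr_ge0 ?mulr_ge0 //.
  by rewrite ltW // lam_gt0.
by rewrite invf_le1 ?mulr_gt0 // -natrM ler1n muln_gt0.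
Qed.

Let jump_ge v m (k : nat) o : Xset N r v -> grid m k -> p0 <=
  jump_prob N K (Ham_p L (xg R N m) (tg R K k) (c + Dx N (phi v k) m)) o.
Proof.
move=> vX gm; apply: jump_prob_le => // j.
by rewrite (le_trans (ler_norm_coord _ _)) // Hp_le.
Qed.

Lemma phi_Xset v q : Xset N r v -> Xset N r (phi v (K.*2 * q)%N).
Proof.
move=> vX; elim: q => [|q IH]; first by rewrite muln0.
by rewrite mulnS addnC phi_addk //; exact: phi_X.
Qed.

(** The maximum principle: the averaging in [phi_diff_step] has nonnegative
    coefficients of sum one. *)
Lemma phi_comparison v w (M : R) : Xset N r v -> Xset N r w ->
  (forall m, ~~ ievenx m -> v m - w m <= M) ->
  forall (k : nat) m, tgrid m k -> phi v k m - phi w k m <= M.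
Proof.
move=> vX wX vw; elim=> [|k IH] m; first by rewrite tgrid0; exact: vw.
rewrite tgridS => gm.
apply: (le_trans (phi_diff_step N_gt0 K_gt0 hL c v w k m)).
rewrite -[M]mul1r.
rewrite -(jump_prob_sum K d_gt0 N_gt0 (Ham_p L (xg R N m) (tg R K k)
  (c + Dx N (phi w k) m))) mulr_suml.
apply: ler_sum => o _; rewrite ler_wpM2l //; last by rewrite IH ?tgrid_dir.
by rewrite (le_trans (ltW p0_gt0)) // jump_ge.
Qed.

(** A defect of [v - w] at one point is transported along every path, losing at
    most a factor [p0] at each jump. *)
Lemma phi_defect v w (M D : R) a : Xset N r v -> Xset N r w ->
  (forall m, ~~ ievenx m -> v m - w m <= M) -> 0 <= D ->
  ~~ ievenx a -> v a - w a <= M - D ->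
  forall (k : nat) n, reach k n ->
    phi v k (a + n) - phi w k (a + n) <= M - p0 ^+ k * D.
Proof.
move=> vX wX vw D0 oa va k n [s <- ->] {k n}.
elim/last_ind: s => [|s o IH]; first by rewrite big_nil addr0 expr0 mul1r.
rewrite size_rcons -cats1 big_cat big_seq1 /= addrA.
set k := size s in IH *; set y := a + _ in IH *.
have gy : grid (y + dir o) k.
  suff : tgrid y k.
    by rewrite /tgrid /grid ievenxD ievenx_dir; case: ievenx; case: ievent.
  rewrite /y /k; elim: s {IH k y} => [|o' s IH]; first by rewrite big_nil addr0 tgrid0.
  rewrite big_cons addrCA addrC /= tgridS.
  by rewrite -(tgrid_dir _ _ (opp_dir o')) dirN addrK.
apply: (le_trans (phi_diff_step N_gt0 K_gt0 hL c v w k _)).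
set q := jump_prob N K _.
have q0 o' : p0 <= q o' by exact: jump_ge.
rewrite (bigD1 (opp_dir o)) //= dirN addrK.
have sq : \sum_(o' | o' != opp_dir o) q o' = 1 - q (opp_dir o).
  have := jump_prob_sum K d_gt0 N_gt0 (Ham_p L (xg R N (y + dir o)) (tg R K k)
    (c + Dx N (phi w k) (y + dir o))).
  by rewrite (bigD1 (opp_dir o)) //= -/(q _) => sq; apply/eqP; rewrite eq_sym subr_eq addrC -sq.
have le2 : \sum_(o' | o' != opp_dir o)
    q o' * (phi v k (y + dir o + dir o') - phi w k (y + dir o + dir o')) <=
    (1 - q (opp_dir o)) * M.
  rewrite -sq mulr_suml; apply: ler_sum => o' _.
  rewrite ler_wpM2l ?(le_trans (ltW p0_gt0)) //.
  by apply: phi_comparison => //; rewrite tgrid_dir.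
have le1 : q (opp_dir o) * (phi v k y - phi w k y) <=
    q (opp_dir o) * (M - p0 ^+ k * D).
  by rewrite ler_wpM2l ?(le_trans (ltW p0_gt0)).
have le3 : p0 * (p0 ^+ k * D) <= q (opp_dir o) * (p0 ^+ k * D).
  by rewrite ler_wpM2r // mulr_ge0 // exprn_ge0 // ltW.
rewrite exprS -mulrA; lra.
Qed.

Definition osc_le f (D : R) := forall a b, ~~ ievenx a -> ~~ ievenx b ->
  f a - f b <= D.

(** The infimum of [v - w] on the odd grid bounds it later on from below, the
    supremum from above. *)
Lemma osc_phi v w (D : R) (k : nat) : Xset N r v -> Xset N r w -> ievent k ->
  osc_le (v \- w) D -> osc_le (phi v k \- phi w k) D.
Proof.
move=> vX wX ek vw a b oa ob /=.
have h1 m : ~~ ievenx m -> phi v k a - phi w k a - D <= v m - w m.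
  move=> om; rewrite lerBlDr.
  apply: phi_comparison => //; last by rewrite tgrid_even.
  by move=> m' om'; rewrite -lerBlDl; exact: vw.
have : phi w k b - phi v k b <= - (phi v k a - phi w k a - D).
  apply: phi_comparison => //; last by rewrite tgrid_even.
  by move=> m om; have := h1 m om; lra.
lra.
Qed.

(** A multiple of the time period that exceeds the diameter of the grid of the
    torus, counted in jumps. *)
Definition mixing_time : nat := (K.*2 * (N.*2 * d))%N.
Local Notation J := mixing_time.

Let th : R := 1 - p0 ^+ J.

Let th_ge0 : 0 <= th.
Proof. by rewrite subr_ge0 exprn_ile1 // ltW. Qed.

Let th_lt1 : th < 1.
Proof. by rewrite ltrBlDr ltrDl exprn_gt0. Qed.

Let J_even : ievent J.
Proof. by rewrite /mixing_time PoszM ievent_double. Qed.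

Lemma reach_mixing a b : ~~ ievenx a -> ~~ ievenx b ->
  exists n, reach J (b - a - (N.*2)%:Z *: n).
Proof.
move=> oa ob; have [i [n e]] := cell_repP N_gt0 (b - a).
exists n; rewrite e addrK.
have ei : ievenx (cell_rep i).
  have : ievenx (b - a).
    have := ievenxD (b - a) a; rewrite subrK (negbTE oa) (negbTE ob).
    by case: ievenx.
  by rewrite e ievenxD ievenx_double; case: ievenx.
apply: reach_large => //; last by rewrite oddM odd_double.
by rewrite (leq_trans (cell_rep_sum i)) // leq_pmull // double_gt0.
Qed.

Lemma Xset_shift v m n : Xset N r v -> ~~ ievenx m ->
  v (m + (N.*2)%:Z *: n) = v m.
Proof.
move=> [pv _] om.
have ev m' n' : ievenx (m' + (N.*2)%:Z *: n') = ievenx m'.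
  by rewrite ievenxD ievenx_double; case: ievenx.
have := @lattice_periodic d R N 1 (fun m _ => if ievenx m then 0 else v m) _
  m 0 n 0.
rewrite tgrid0 /= ev (negbTE om); apply => // m' k _; split => // j.
by rewrite ev; case: ifP => // /negbT; exact: pv.
Qed.

(** Doeblin's argument: modulo periods, [mixing_time] jumps lead from every
    odd point to every other one with positive probability, so the oscillation of a difference contracts. *)
Lemma osc_contraction v w (D : R) : Xset N r v -> Xset N r w ->
  osc_le (v \- w) D -> osc_le (phi v J \- phi w J) (th * D).
Proof.
move=> vX wX vw a b oa ob /=.
have D0 : 0 <= D by have := vw a a oa oa; rewrite subrr.
have vJ : Xset N r (phi v J) by exact: phi_Xset.
have wJ : Xset N r (phi w J) by exact: phi_Xset.
have h1 m : ~~ ievenx m -> phi v J a - phi w J a - th * D <= v m - w m.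
  move=> om; have [n rn] := reach_mixing om oa.
  have := @phi_defect v w (v m - w m + D) D m vX wX _ D0 om _ _ _ rn.
  (* Start from the defect at [m]: there [v - w] is [D] below the upper bound. *)
  have -> : m + (a - m - (N.*2)%:Z *: n) = a + (N.*2)%:Z *: (- n).
    by rewrite scalerN addrA addrCA subrr addr0.
  rewrite (Xset_shift _ vJ) // (Xset_shift _ wJ) // /th mulrBl mul1r => H.
  rewrite lerBlDr (le_trans (H _ _)) //; last 1 first.
  - lra.
  - by move=> m' om'; rewrite -lerBlDl; exact: vw.
  - lra.
have : phi w J b - phi v J b <= - (phi v J a - phi w J a - th * D).
  apply: phi_comparison => //; last by rewrite tgrid_even.
  by move=> m om; have := h1 m om; lra.
lra.
Qed.

Lemma osc_bounded v : Xset N r v -> exists C, osc_le v C.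
Proof.
move=> vX.
pose F (i : {ffun 'I_d -> 'I_(N.*2)}) := if ievenx (cell_rep i) then 0 else `|v (cell_rep i)|.
pose C := \sum_(i : {ffun 'I_d -> 'I_(N.*2)}) F i.
have F0 i : 0 <= F i by rewrite /F; case: ifP.
have vC m : ~~ ievenx m -> `|v m| <= C.
  have [i [n ->]] := cell_repP N_gt0 m; rewrite ievenxD ievenx_double => oi.
  have {}oi : ~~ ievenx (cell_rep i) by move: oi; case: ievenx.
  rewrite (Xset_shift _ vX) // /C (bigD1 i) //= {1}/F (negbTE oi) lerDl.
  exact: sumr_ge0.
exists (C + C) => a b oa ob.
have := vC a oa; have := vC b ob; rewrite !ler_norml => /andP[? ?] /andP[? ?].
lra.
Qed.

Lemma osc_contraction_iter v w (D : R) q : Xset N r v -> Xset N r w ->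
  osc_le (v \- w) D ->
  osc_le (phi v (J * q)%N \- phi w (J * q)%N) (D * th ^+ q).
Proof.
move=> vX wX vw; elim: q => [|q IH]; first by rewrite muln0 expr0 mulr1.
have e u : phi u (J * q.+1)%N = phi (phi u (J * q)%N) J.
  by rewrite mulnSr /mixing_time -mulnA phi_addk.
rewrite !e exprS mulrCA.
apply: osc_contraction => //; rewrite /mixing_time -mulnA; exact: phi_Xset.
Qed.

Lemma Xset0 : Xset N r (cst 0 : 'rV[int]_d -> R).
Proof.
split=> // m _; rewrite (_ : Dx N (cst 0) m = 0) ?normr0 ?ltW //.
exact: Dx_cst.
Qed.

Lemma osc_subr f g (C D : R) : osc_le f C -> osc_le g D -> osc_le (f \- g) (C + D).
Proof.
by move=> hf hg a b oa ob /=; have := hf a b oa ob; have := hg b a ob oa; lra.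
Qed.

Let a0 : 'rV[int]_d := ei (Ordinal d_gt0).
Let a0_odd : ~~ ievenx a0.
Proof. by rewrite /a0 -dir_false ievenx_dir. Qed.

Let W q := phi (cst 0) (J * q)%N.
Let WX q : Xset N r (W q).
Proof. by rewrite /W /mixing_time -mulnA; apply: phi_Xset; exact: Xset0. Qed.

(** The successive increments of the iterates of [0] are differences of two
    evolutions, so their oscillation decays geometrically; normalizing at [a0]
    turns a bound on the oscillation into a bound on the values. *)
Lemma normalized_limit : exists2 u, Xset N r u &
  exists C : R, forall q m, ~~ ievenx m ->
    `|u m - (W q m - W q a0)| <= C * th ^+ q.
Proof.
have [C hC] : exists C, osc_le (phi (cst 0) J \- cst 0) C.
  have [C1 h1] := osc_bounded (WX 1); rewrite /W muln1 in h1.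
  by exists (C1 + 0); apply: osc_subr => // a b _ _; rewrite subrr.
have C0 : 0 <= C by have := hC a0 a0 a0_odd a0_odd; rewrite subrr.
have step q m : ~~ ievenx m ->
    `|(W q.+1 m - W q.+1 a0) - (W q m - W q a0)| <= C * th ^+ q.
  move=> om.
  have JX : Xset N r (phi (cst 0) J) by have := WX 1; rewrite /W muln1.
  have h := osc_contraction_iter q JX Xset0 hC.
  have e : W q.+1 = phi (phi (cst 0) J) (J * q)%N.
    rewrite /W mulnS {1 3}/mixing_time.
    have := @phi_addk R d N K K_gt0 L hL c (cst 0) (J * q)%N (N.*2 * d)%N.
    by [].
  rewrite e /W ler_norml.
  have := h _ _ om a0_odd; have := h _ _ a0_odd om => /=; lra.
have lim m : exists u : R, ~~ ievenx m -> forall q,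
    `|u - (W q m - W q a0)| <= C / (1 - th) * th ^+ q.
  have [em|om] := boolP (ievenx m); first by exists 0.
  by have [u hu] := geometric_limit C0 th_ge0 th_lt1 (fun q => step q m om); exists u.
pose u m : R := projT1 (cid (lim m)).
have uP m : ~~ ievenx m -> forall q,
    `|u m - (W q m - W q a0)| <= C / (1 - th) * th ^+ q.
  exact: (projT2 (cid (lim m))).
set M := C / (1 - th) in uP.
exists u; last by exists M => q m om; exact: uP.
split=> [m j om|m em].
  have om' : ~~ ievenx (m + (N.*2)%:Z *: ei j).
    by rewrite ievenxD ievenx_double; move: om; case: ievenx.
  apply/eqP; rewrite -subr_eq0 -normr_le0.
  apply: (@le_geometric R (M + M) th) => // q; rewrite add0r.
  have := uP _ om' q; have := uP _ om q.
  rewrite (WX q).1 // !ler_norml => /andP[? ?] /andP[? ?]; apply/andP; lra.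
have h0 := @h_gt0 R N N_gt0.
apply: norm_row_le => [|j]; first exact: ltW.
apply: (@le_geometric R ((M + M) / (2 * h R N)) th) => // q.
have op : ~~ ievenx (m + ei j) by rewrite -dir_false ievenxD ievenx_dir em.
have om : ~~ ievenx (m - ei j) by rewrite -dir_true ievenxD ievenx_dir em.
have hW : `|Dx N (W q) m 0 j| <= r.
  by rewrite (le_trans (ler_norm_coord _ _)) // (WX q).2.
move: hW; rewrite !mxE !normrM normfV (@gtr0_norm _ (2 * h R N)) ?mulr_gt0 //.
have i0 : 0 < (2 * h R N)^-1 by rewrite invr_gt0 mulr_gt0.
set A := _^-1 in i0 *.
move=> hW; have : `|u (m + ei j) - u (m - ei j)| <=
    `|W q (m + ei j) - W q (m - ei j)| + (M + M) * th ^+ q.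
  have := uP _ op q; have := uP _ om q; have := ler_norm (W q (m + ei j) - W q (m - ei j)).
  have := lerNnormlW (lexx `|W q (m + ei j) - W q (m - ei j)|).
  rewrite !ler_norml => ? ? /andP[? ?] /andP[? ?]; apply/andP; lra.
move=> /(ler_wpM2r (ltW i0)); rewrite mulrDl => h1; apply: (le_trans h1).
by rewrite mulrAC lerD2r; exact: hW.
Qed.

(** For the iterates [W q] the oscillation of one more period minus [W q] tends
    to zero, since time translations commute with the evolution; by
    nonexpansiveness this passes to the limit. *)
Lemma fixed_point : exists2 v, Xset N r v &
  exists x : R, forall m, ~~ ievenx m -> phi v K.*2 m + x = v m.
Proof.
have [u uX [C hC]] := normalized_limit.
have e2K : ievent K.*2 by rewrite -[K.*2%:Z]mulr1 ievent_double.
have PX : Xset N r (phi (cst 0) K.*2) by apply: phi_X; exact: Xset0.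
have [C1 h1] : exists C, osc_le (phi (cst 0) K.*2 \- cst 0) C.
  have [C1 h1] := osc_bounded PX.
  by exists (C1 + 0); apply: osc_subr => // a b _ _; rewrite subrr.
have ou q : osc_le (u \- W q) (C * th ^+ q + C * th ^+ q).
  move=> a b oa ob /=; have := hC q a oa; have := hC q b ob.
  rewrite !ler_norml => /andP[? ?] /andP[? ?]; lra.
have o0 : osc_le (phi u K.*2 \- u) 0.
  move=> a b oa ob.
  apply: (@le_geometric R (C + C + C1 + (C + C)) th) => // q; rewrite add0r.
  have s1 := osc_phi uX (WX q) e2K (ou q).
  have s2 := osc_contraction_iter q PX Xset0 h1.
  have e : phi (phi (cst 0) K.*2) (J * q)%N = phi (W q) K.*2.
    have h3 := @phi_addk R d N K K_gt0 L hL c (cst 0).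
    have := h3 (J * q)%N 1%N; rewrite muln1 => <-.
    by rewrite /W /mixing_time -mulnA -h3 addnC.
  rewrite e in s2.
  have := s1 a b oa ob; have := s2 a b oa ob; have := ou q b a ob oa.
  rewrite /= /W; lra.
exists u => //; exists (u a0 - phi u K.*2 a0) => m om.
have := o0 m a0 om a0_odd; have := o0 a0 m a0_odd om => /=; lra.
Qed.

Lemma effective_HP : exists2 v, Xset N r v &
  forall m, ~~ ievenx m -> phi v K.*2 m + effective_H N K L r c = v m.
Proof.
have [v vX [x hx]] := fixed_point.
rewrite /effective_H; case: xgetP => [y _ []|no]; first by move=> w wX hw; exists w.
by exfalso; apply: (no x); exists v.
Qed.

End FixedPoint.

(** * Solutions of the discrete cell equation *)

Section CellSolutions.
Context (R : realType) (d N K : nat).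
Hypotheses (d_gt0 : (0 < d)%N) (N_gt0 : (0 < N)%N) (K_gt0 : (0 < K)%N).
Variables (L : 'rV[R]_d * R * 'rV[R]_d -> R) (r : R) (c : 'rV[R]_d).
Hypotheses (hL : Lagrangian_hyps L).
Local Notation phi := (phi N K L ^~ c).
Local Notation Hbar := (effective_H N K L r c).
Implicit Types (m : 'rV[int]_d) (k : int) (o : Bset d) (f g : 'rV[int]_d -> R).

Lemma avg_local f g m : (forall o, f (m + dir o) = g (m + dir o)) ->
  avg f m = avg g m.
Proof. by move=> fg; congr (_ * _); apply: eq_bigr => o _; exact: fg. Qed.

Lemma Dx_local f g m : (forall o, f (m + dir o) = g (m + dir o)) ->
  Dx N f m = Dx N g m.
Proof.
move=> fg; apply/rowP => j; rewrite !mxE.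
by have := fg (j, false); have := fg (j, true); rewrite dir_false dir_true => -> ->.
Qed.

(** Running the scheme from a fixed point over one period, with the drift
    [Hbar] added, closes up into a time-periodic solution. *)
Lemma cell_solution_exists :
  (exists2 v0, Xset N r v0 &
     forall m, ~~ ievenx m -> phi v0 K.*2 m + Hbar = v0 m) ->
  exists v, cell_solution N K L r c v.
Proof.
move=> [v0 v0X fixv0].
have t0 := @tau_gt0 R K K_gt0.
have K2 : (K.*2)%:Z != 0 by lia.
pose a k : nat := `|(k %% (K.*2)%:Z)%Z|%N.
pose v m k : R := phi v0 (a k) m + tau R K * (a k)%:R * Hbar.
have aE (b : nat) z : (b < K.*2)%N -> a (b%:Z + (K.*2)%:Z * z) = b.
  by move=> bK; rewrite /a addrC mulrC modzMDl modz_small //; lia.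
exists v; split.
- move=> m k tm; have [b [z [bK ek]]] := int_period k K_gt0.
  rewrite ek in tm *.
  have tmb : tgrid m b by have := tgrid_shift 0 K m 0 b z; rewrite scaler0 addr0 => <-.
  split=> [j|].
    by rewrite /v aE // (phi_periodic K N_gt0 hL c v0X.1 j tmb).
  by rewrite -addrA -{2}[(K.*2)%:Z]mulr1 -mulrDr /v !aE.
- have -> : v^~ 0 = v0; last by [].
  by apply/funext => m; rewrite /v /a mod0z /= mulr0 mul0r addr0.
- move=> m k gm; have [b [z [bK ek]]] := int_period k K_gt0.
  have vb m' : v m' k = phi v0 b m' + tau R K * b%:R * Hbar by rewrite /v ek aE.
  (* At the end of the period the fixed point equation closes the cycle. *)
  have vb1 : v m (k + 1) = phi v0 b.+1 m + tau R K * (b.+1)%:R * Hbar.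
    have [bK1|bK1] := ltnP b.+1 K.*2.
      by rewrite /v ek -addrA [_ * z + 1]addrC addrA -PoszD addn1 aE.
    have eb : b.+1 = K.*2 by lia.
    have om : ~~ ievenx m.
      move: gm; rewrite -tgrid_step ek -addrA [_ * z + 1]addrC addrA -PoszD addn1 eb.
      by rewrite tgrid_even // ieventD ievent_double -[K.*2%:Z]mulr1 ievent_double.
    rewrite eb tau_period // mul1r fixv0 // /v ek.
    rewrite -addrA [_ * z + 1]addrC addrA -PoszD addn1 eb.
    have -> : a ((K.*2)%:Z + (K.*2)%:Z * z) = 0%N.
      have := aE 0%N (1 + z); rewrite add0r mulrDr mulr1; apply.
      by rewrite double_gt0.
    by rewrite mulr0n mulr0 mul0r addr0.
  have -> : v^~ k = phi v0 b \+ cst (tau R K * b%:R * Hbar).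
    by apply/funext => m'; rewrite vb.
  rewrite /Dt addrK vb1.
  have -> : v^~ k = phi v0 b \+ cst (tau R K * b%:R * Hbar).
    by apply/funext => m'; rewrite vb.
  rewrite DxD Dx_cst addr0 avgD avg_cst //= ek tg_shift //.
  have := Ham_lattice hL (xg R N m) (tg R K b) 0 z.
  rewrite map_mx0 addr0 => ->.
  rewrite -natr1; field; by rewrite gt_eqF.
Qed.

Section GivenSolution.
Variable v : 'rV[int]_d -> int -> R.
Hypothesis vP : cell_solution N K L r c v.

Lemma cell_step m k : grid m k -> v m (k + 1) =
  avg (v^~ k) m - tau R K * Ham L (xg R N m) (tg R K k) (c + Dx N (v^~ k) m)
  + tau R K * Hbar.
Proof.
have [_ _ ev] := vP => /ev; rewrite /Dt addrK => <-.
by have t0 := @tau_gt0 R K K_gt0; field; rewrite gt_eqF.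
Qed.

Definition gap m k (zeta : 'rV[R]_d) : R :=
  Ham L (xg R N m) (tg R K k) (c + Dx N (v^~ k) m) +
  L (xg R N m, tg R K k, zeta) - dotp (c + Dx N (v^~ k) m) zeta.

Lemma gap_ge0 m k zeta : 0 <= gap m k zeta.
Proof.
have := Ham_fenchel hL (xg R N m) (tg R K k) (c + Dx N (v^~ k) m) zeta.
by rewrite /gap; lra.
Qed.

Lemma gap_eq0 m k zeta : gap m k zeta = 0 ->
  zeta = Ham_p L (xg R N m) (tg R K k) (c + Dx N (v^~ k) m).
Proof. by move=> g0; apply: Ham_fenchel_eq => //; move: g0; rewrite /gap; lra. Qed.

Lemma gap_optimal m k :
  gap m k (Ham_p L (xg R N m) (tg R K k) (c + Dx N (v^~ k) m)) = 0.
Proof.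
have := Ham_fenchel_p hL (xg R N m) (tg R K k) (c + Dx N (v^~ k) m).
rewrite /gap; lra.
Qed.

(** The dynamic programming identity for an arbitrary control; [gap] measures
    its failure to be optimal. *)
Lemma cell_control m k zeta : grid m k ->
  \sum_o jump_prob N K zeta o * v (m + dir o) k =
  v m (k + 1) - tau R K * Lc L c (xg R N m) (tg R K k) zeta
  - tau R K * Hbar + tau R K * gap m k zeta.
Proof.
move=> gm; rewrite (jump_prob_avg K N_gt0 zeta (v^~ k)) cell_step //.
by rewrite /gap /Lc dotpDl; ring.
Qed.

(** On the natural times a solution is the evolution of its initial datum, up
    to the constant drift; this transfers bounds known along evolutions. *)
Lemma cell_phi (k : nat) m : tgrid m k ->
  v m k = phi (v^~ 0) k m + tau R K * k%:R * Hbar.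
Proof.
elim: k m => [|k IH] m tm; first by rewrite mulr0 mul0r addr0.
rewrite intS addrC cell_step -?tgridS //=.
rewrite tgridS in tm.
have IH' o : v (m + dir o) k =
    (phi (v^~ 0) k \+ cst (tau R K * k%:R * Hbar)) (m + dir o).
  by rewrite IH ?tgrid_dir.
rewrite (avg_local IH') (Dx_local IH') DxD Dx_cst addr0 avgD avg_cst //.
by rewrite -natr1; ring.
Qed.

Lemma cell_grad_periodic m k n z : grid m k ->
  Dx N (v^~ (k + (K.*2)%:Z * z)) (m + (N.*2)%:Z *: n) = Dx N (v^~ k) m.
Proof.
have [pv _ _] := vP.
move=> gm; apply/rowP => j; rewrite !mxE.
have e o : v (m + (N.*2)%:Z *: n + dir o) (k + (K.*2)%:Z * z) = v (m + dir o) k.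
  by rewrite addrAC (lattice_periodic pv) ?tgrid_dir.
by have := e (j, false); have := e (j, true); rewrite dir_false dir_true => -> ->.
Qed.

Lemma cell_Hp_bound (B : R) :
  (forall w, Xset N r w -> forall m (k : nat), grid m k ->
    `|Ham_p L (xg R N m) (tg R K k) (c + Dx N (phi w k) m)| <= B) ->
  forall m k, grid m k ->
    `|Ham_p L (xg R N m) (tg R K k) (c + Dx N (v^~ k) m)| <= B.
Proof.
move=> hB m k gm; have [b [z [_ ek]]] := int_period k K_gt0.
have gmb : grid m b.
  move: gm; rewrite -(tgrid_dir _ _ (Ordinal d_gt0, false)) ek.
  by have := tgrid_shift 0 K (m + dir (Ordinal d_gt0, false)) 0 b z;
     rewrite scaler0 addr0 => ->; rewrite tgrid_dir.
have [_ vX _] := vP.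
have := hB _ vX m b gmb.
have -> : Dx N (v^~ k) m = Dx N (phi (v^~ 0) b) m.
  have := @cell_grad_periodic m b 0 z gmb; rewrite scaler0 addr0 -ek => ->.
  have e o : v (m + dir o) b =
      (phi (v^~ 0) b \+ cst (tau R K * b%:R * Hbar)) (m + dir o).
    by rewrite cell_phi ?tgrid_dir.
  by rewrite (Dx_local e) DxD Dx_cst addr0.
rewrite ek tg_shift // /Ham_p.
by have := Ham_lattice hL (xg R N m) (tg R K b) 0 z; rewrite map_mx0 addr0 => ->.
Qed.

End GivenSolution.
End CellSolutions.

(** * The random walk and its occupation weights *)

Section Walk.
Context (R : realType) (d N K : nat).
Hypotheses (d_gt0 : (0 < d)%N) (N_gt0 : (0 < N)%N) (K_gt0 : (0 < K)%N).
Variables (n0 : 'rV[int]_d) (xi : 'rV[int]_d -> int -> 'rV[R]_d).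
Implicit Types (m : 'rV[int]_d) (k : int) (f g : 'rV[int]_d -> R) (l i : nat).

Definition extend_path l (o : {ffun 'I_l -> Bset d}) (w : Bset d) :
    {ffun 'I_l.+1 -> Bset d} :=
  [ffun i : 'I_l.+1 => oapp o w (insub (i : nat))].

Lemma extend_path_widen l (o : {ffun 'I_l -> Bset d}) w (j : 'I_l) :
  extend_path o w (widen_ord (leqnSn l) j) = o j.
Proof. by rewrite ffunE /= valK. Qed.

Lemma extend_path_last l (o : {ffun 'I_l -> Bset d}) w :
  extend_path o w ord_max = w.
Proof. by rewrite ffunE /= insubN // -leqNgt. Qed.

Lemma walk_extend l (o : {ffun 'I_l -> Bset d}) w i : (i <= l)%N ->
  walk n0 (extend_path o w) i = walk n0 o i.
Proof.
move=> il; rewrite /walk; congr (_ + _).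
rewrite big_mkcond big_ord_recr /= ltnNge il /= addr0 [RHS]big_mkcond /=.
by apply: eq_bigr => j _; rewrite extend_path_widen.
Qed.

Lemma walk_extend_last l (o : {ffun 'I_l -> Bset d}) w :
  walk n0 (extend_path o w) l.+1 = walk n0 o l + dir w.
Proof.
rewrite /walk -addrA; congr (_ + _).
rewrite big_mkcond big_ord_recr /= ltnS leqnn extend_path_last; congr (_ + _).
rewrite [RHS]big_mkcond /=; apply: eq_bigr => j _.
by rewrite extend_path_widen ltnS ltnW ltn_ord.
Qed.

(** Conditioning on all jumps but the last. *)
Lemma walk_expectationS l (X : {ffun 'I_l.+1 -> Bset d} -> R) :
  walk_expectation N K n0 xi X =
  walk_expectation N K n0 xi (fun o : {ffun 'I_l -> Bset d} =>
    \sum_w jump_prob N K (xi (walk n0 o l) (- l%:Z)) w * X (extend_path o w)).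
Proof.
rewrite /walk_expectation.
pose join (p : {ffun 'I_l -> Bset d} * Bset d) := extend_path p.1 p.2.
pose unjoin (o : {ffun 'I_l.+1 -> Bset d}) :=
  ([ffun j => o (widen_ord (leqnSn l) j)] : {ffun 'I_l -> Bset d}, o ord_max).
have joinK : cancel join unjoin.
  move=> [p w]; rewrite /unjoin /join /= extend_path_last; congr (_, _).
  by apply/ffunP => j; rewrite ffunE extend_path_widen.
have splitK : cancel unjoin join.
  move=> o; apply/ffunP => i; rewrite /join /unjoin /= ffunE.
  have [il|il] := ltnP i l.
    rewrite insubT /= ffunE; congr (o _); exact: val_inj.
  rewrite insubN -?leqNgt //=; congr (o _); apply: val_inj => /=.
  by apply/eqP; rewrite eqn_leq il -ltnS ltn_ord.
rewrite (reindex join) /=; last first.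
  exists unjoin; move=> p _; first exact: joinK.
  exact: splitK.
under [RHS]eq_bigr do rewrite mulr_sumr.
rewrite pair_bigA /=; apply: eq_bigr => -[p w] _ /=.
rewrite mulrA; congr (_ * _).
rewrite /join /= /walk_prob big_ord_recr /= walk_extend // extend_path_last.
congr (_ * _); apply: eq_bigr => j _.
by rewrite extend_path_widen walk_extend // ltnW // ltn_ord.
Qed.

Definition transition k g m : R :=
  \sum_o jump_prob N K (xi m k) o * g (m + dir o).

(** The expectation of [g] at the position after [l] jumps, computed by
    averaging over the last jump first instead of summing over paths. *)
Fixpoint walk_mean l g : R :=
  if l is l'.+1 then walk_mean l' (transition (- l'%:Z) g) else g n0.

Lemma walk_expectation_last l g :
  walk_expectation N K n0 xi (fun o : {ffun 'I_l -> Bset d} => g (walk n0 o l)) =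
  walk_mean l g.
Proof.
elim: l g => [|l IH] g.
  rewrite /walk_expectation (bigD1 [ffun=> (Ordinal d_gt0, false)]) //= big1.
    by rewrite addr0 /walk_prob big_ord0 mul1r /walk big_ord0 addr0.
  by move=> o /eqP[]; apply/ffunP => -[].
rewrite walk_expectationS /= -IH /walk_expectation.
apply: eq_bigr => o _; congr (_ * _).
by apply: eq_bigr => w _; rewrite walk_extend_last.
Qed.

Lemma walk_expectation_marginal l i g : (i <= l)%N ->
  walk_expectation N K n0 xi (fun o : {ffun 'I_l -> Bset d} => g (walk n0 o i)) =
  walk_mean i g.
Proof.
elim: l => [|l IH]; first by rewrite leqn0 => /eqP ->; exact: walk_expectation_last.
rewrite leq_eqVlt => /orP[/eqP ->|il]; first exact: walk_expectation_last.
rewrite walk_expectationS -IH // /walk_expectation.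
apply: eq_bigr => o _; congr (_ * _).
under eq_bigr do rewrite walk_extend //.
by rewrite -mulr_suml jump_prob_sum // mul1r.
Qed.

Lemma walk_mean_sum (I : finType) (a : I -> R) (g : I -> 'rV[int]_d -> R) l :
  walk_mean l (fun m => \sum_e a e * g e m) = \sum_e a e * walk_mean l (g e).
Proof.
elim: l g => [//|l IH] g /=; rewrite -IH; congr walk_mean.
apply/funext => m; rewrite /transition.
under eq_bigr do rewrite mulr_sumr.
rewrite exchange_big /=; apply: eq_bigr => e _.
by rewrite mulr_sumr; apply: eq_bigr => o _; rewrite mulrCA.
Qed.

Lemma walk_mean_cst (x : R) l : walk_mean l (cst x) = x.
Proof.
elim: l => [//|l IH] /=; rewrite -[RHS]IH; congr walk_mean.
by apply/funext => m; rewrite /transition -mulr_suml jump_prob_sum // mul1r.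
Qed.

Lemma walk_meanD f g (x : R) l :
  walk_mean l (fun m => f m + x * g m) = walk_mean l f + x * walk_mean l g.
Proof.
have := walk_mean_sum (fun b : bool => if b then 1 else x)
  (fun b m => if b then f m else g m) l.
rewrite big_bool /= mul1r => <-; congr walk_mean.
by apply/funext => m; rewrite big_bool /= mul1r.
Qed.

Hypothesis n0_odd : ~~ ievenx n0.
Hypothesis xi_adm : admissible N K xi.

(** Only the points that the walk can visit matter, and there the jump
    probabilities are nonnegative. *)
Lemma walk_mean_le l f g : (forall m, tgrid m (- l%:Z) -> f m <= g m) ->
  walk_mean l f <= walk_mean l g.
Proof.
elim: l f g => [|l IH] f g fg /=; first by apply: fg; rewrite oppr0 tgrid0.
apply: IH => m tm; apply: ler_sum => o _; rewrite ler_wpM2l //.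
  by apply: jump_prob_ge0 => // j; exact: xi_adm.2.
apply: fg; rewrite tgrid_dir -tgrid_step; move: tm.
by congr (is_true (tgrid m _)); lia.
Qed.

Lemma eq_walk_mean l f g : (forall m, tgrid m (- l%:Z) -> f m = g m) ->
  walk_mean l f = walk_mean l g.
Proof.
move=> fg; apply/eqP; rewrite eq_le.
by rewrite !walk_mean_le // => m tm; rewrite fg.
Qed.

Definition lattice_invariant (T : Type) (F : 'rV[int]_d -> int -> T) :=
  forall m k n z, tgrid m k -> F (m + (N.*2)%:Z *: n) (k + (K.*2)%:Z * z) = F m k.

(** These indices enumerate a fundamental domain of the space-time lattice;
    [pr_tgrid] is the part of it of the right parity. *)
Definition cell_index : finType := ({ffun 'I_d -> 'I_(N.*2)} * 'I_(K.*2))%type.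
Definition cell_m (e : cell_index) : 'rV[int]_d := cell_rep e.1.
Definition cell_k (e : cell_index) : int := (e.2 : nat)%:Z.

Lemma cell_index_exists m k : exists e n z,
  m = cell_m e + (N.*2)%:Z *: n /\ k = cell_k e + (K.*2)%:Z * z.
Proof.
have [i [n ->]] := cell_repP N_gt0 m.
have [a [z [aK ->]]] := int_period k K_gt0.
by exists (i, Ordinal aK), n, z.
Qed.

Definition cell_of m k : cell_index := projT1 (cid (cell_index_exists m k)).

Lemma cell_ofP m k : exists n z,
  m = cell_m (cell_of m k) + (N.*2)%:Z *: n /\
  k = cell_k (cell_of m k) + (K.*2)%:Z * z.
Proof. exact: (projT2 (cid (cell_index_exists m k))). Qed.

Lemma tgrid_cell_of m k :
  tgrid (cell_m (cell_of m k)) (cell_k (cell_of m k)) = tgrid m k.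
Proof.
have [n [z [em ek]]] := cell_ofP m k.
have := tgrid_shift N K (cell_m (cell_of m k)) n (cell_k (cell_of m k)) z.
by rewrite -em -ek => ->.
Qed.

Lemma invariant_cell_of (T : Type) (F : 'rV[int]_d -> int -> T) m k :
  lattice_invariant F -> tgrid m k ->
  F (cell_m (cell_of m k)) (cell_k (cell_of m k)) = F m k.
Proof.
move=> iF tm; have [n [z [em ek]]] := cell_ofP m k.
have := iF (cell_m (cell_of m k)) (cell_k (cell_of m k)) n z.
by rewrite -em -ek tgrid_cell_of => ->.
Qed.

(** The expected fraction of its first [l] steps that the walk spends at a
    point of the space-time torus. *)
Definition weight l (e : cell_index) : R :=
  l%:R^-1 * \sum_(i < l) walk_mean i (fun m => (cell_of m (- i%:Z) == e)%:R).

Lemma weight_ge0 l e : 0 <= weight l e.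
Proof.
rewrite mulr_ge0 ?invr_ge0 //; apply: sumr_ge0 => i _.
rewrite -[X in X <= _](walk_mean_cst 0 i).
by apply: walk_mean_le => m _.
Qed.

Lemma weight_tgrid l e : ~~ tgrid (cell_m e) (cell_k e) -> weight l e = 0.
Proof.
move=> te; rewrite /weight big1 ?mulr0 // => i _.
rewrite -[RHS](walk_mean_cst 0 i); apply: eq_walk_mean => m tm /=.
case: eqP => // e1; move: te; rewrite -e1 tgrid_cell_of.
by rewrite tm.
Qed.

(** Grouping the terms of a time average by the visited point of the torus. *)
Lemma occupation_sum l (F : 'rV[int]_d -> int -> R) : lattice_invariant F ->
  l%:R^-1 * \sum_(i < l) walk_mean i (F ^~ (- i%:Z)) =
  \sum_e weight l e * F (cell_m e) (cell_k e).
Proof.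
move=> iF; rewrite /weight.
under [RHS]eq_bigr do rewrite -mulrA mulr_suml.
rewrite -mulr_sumr exchange_big /=; congr (_ * _); apply: eq_bigr => i _.
under [RHS]eq_bigr do rewrite mulrC.
rewrite -walk_mean_sum; apply: eq_walk_mean => m tm.
rewrite (bigD1 (cell_of m (- i%:Z))) //= eqxx mulr1 big1 ?addr0.
  by rewrite invariant_cell_of.
by move=> e ne; rewrite eq_sym (negbTE ne) mulr0.
Qed.

Lemma weight_sum l : (0 < l)%N -> \sum_e weight l e = 1.
Proof.
move=> l0; transitivity (\sum_e weight l e * 1).
  by apply: eq_bigr => e _; rewrite mulr1.
rewrite -(@occupation_sum l (fun _ _ => 1)) //.
under eq_bigr do rewrite (walk_mean_cst 1).
by rewrite sumr_const card_ord mulVf // pnatr_eq0 -lt0n.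
Qed.

Lemma walk_expectation_occupation l (F : 'rV[int]_d -> int -> R) :
  (0 < l)%N -> lattice_invariant F ->
  walk_expectation N K n0 xi (fun o : {ffun 'I_l -> Bset d} =>
     (tg R K l)^-1 * \sum_(i < l) F (walk n0 o i) (- i%:Z) * tau R K) =
  \sum_e weight l e * F (cell_m e) (cell_k e).
Proof.
move=> l0 iF; rewrite -occupation_sum //.
have -> : \sum_(i < l) walk_mean i (F ^~ (- i%:Z)) = \sum_(i < l)
   walk_expectation N K n0 xi (fun o : {ffun 'I_l -> Bset d} =>
     F (walk n0 o i) (- i%:Z)).
  apply: eq_bigr => i _; rewrite (walk_expectation_marginal (F ^~ (- i%:Z))) //.
  by rewrite ltnW.
rewrite /walk_expectation exchange_big mulr_sumr /=; apply: eq_bigr => o _.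
rewrite -[in RHS]mulr_sumr [RHS]mulrCA; congr (_ * _).
rewrite -mulr_suml /tg /= invfM.
have t0 := @tau_gt0 R K K_gt0.
have l1 : l%:R != 0 :> R by rewrite pnatr_eq0 -lt0n.
by field; rewrite l1 gt_eqF.
Qed.

End Walk.

(** * The space-time torus *)

Section Quotients.
Context (R : realType) (d : nat).
Implicit Types (x y : 'rV[R]_d) (s t : R).

Lemma to_torus_eq x y : to_torus x = to_torus y <-> torus_rel x y.
Proof. by split=> /eqmodP. Qed.

Lemma to_circle_eq s t : to_circle s = to_circle t <-> circle_rel s t.
Proof. by split=> /eqmodP. Qed.

Lemma of_torusK X : to_torus (of_torus X : 'rV[R]_d) = X.
Proof. exact: (@reprK _ {eq_quot @torus_rel R d}%qT X). Qed.

Lemma of_circleK T : to_circle (of_circle T : R) = T.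
Proof. exact: (@reprK _ {eq_quot @circle_rel R}%qT T). Qed.

Lemma torus_relP x y : torus_rel x y <-> exists n : 'rV[int]_d, x = y + map_mx intr n.
Proof.
split=> [/forallP xy|[n ->]]; last first.
  by apply/forallP => j; rewrite !mxE addrAC subrr add0r intr_int.
exists (\row_j Num.floor (x 0 j - y 0 j)); apply/rowP => j; rewrite !mxE.
by rewrite floorK ?xy // addrC subrK.
Qed.

Lemma circle_relP s t : circle_rel s t <-> exists n : int, s = t + n%:~R.
Proof.
split=> [st|[n ->]]; last by rewrite /circle_rel addrAC subrr add0r intr_int.
by exists (Num.floor (s - t)); rewrite floorK // addrC subrK.
Qed.

Lemma to_torus_shift x (n : 'rV[int]_d) : to_torus (x + map_mx intr n) = to_torus x.
Proof. by apply/to_torus_eq/torus_relP; exists n. Qed.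

Lemma to_circle_shift t (n : int) : to_circle (t + n%:~R) = to_circle t.
Proof. by apply/to_circle_eq/circle_relP; exists n. Qed.

Lemma of_to_torus x : exists n : 'rV[int]_d, of_torus (to_torus x) = x + map_mx intr n.
Proof. by apply/torus_relP/to_torus_eq; rewrite of_torusK. Qed.

Lemma of_to_circle t : exists n : int, of_circle (to_circle t) = t + n%:~R.
Proof. by apply/circle_relP/to_circle_eq; rewrite of_circleK. Qed.

(** The projections are open, the preimage of an image being a union of
    translates. *)
Lemma to_torus_open x (A : set 'rV[R]_d) : nbhs x A ->
  nbhs (to_torus x) (@to_torus R d @` A).
Proof.
rewrite nbhsE => -[B [oB Bx] BA].
apply: (filterS (image_subset _ BA)).
apply: open_nbhs_nbhs; split; last by exists x.
rewrite /open /= /quotient_open.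
have -> : (\pi_{eq_quot @torus_rel R d})%qT @^-1` (@to_torus R d @` B) =
    \bigcup_(n in [set: 'rV[int]_d]) ((fun y : 'rV[R]_d => y + map_mx intr n) @^-1` B).
  apply/seteqP; split=> [y [b Bb /esym e]|y [n _ Bn]]; last first.
    exists (y + map_mx intr n) => //; exact: to_torus_shift.
  have : to_torus b = to_torus y by [].
  by move=> /to_torus_eq/torus_relP[n en]; exists n => //=; rewrite -en.
apply: bigcup_open => n _; apply: open_comp => // y _.
by apply: (@cvgD _ _ _ (nbhs y)); [exact: cvg_id|exact: cvg_cst].
Qed.

Lemma to_circle_open t (A : set R) : nbhs t A ->
  nbhs (to_circle t) (@to_circle R @` A).
Proof.
rewrite nbhsE => -[B [oB Bx] BA].
apply: (filterS (image_subset _ BA)).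
apply: open_nbhs_nbhs; split; last by exists t.
rewrite /open /= /quotient_open.
have -> : (\pi_{eq_quot @circle_rel R})%qT @^-1` (@to_circle R @` B) =
    \bigcup_(n in [set: int]) ((fun y : R => y + n%:~R) @^-1` B).
  apply/seteqP; split=> [y [b Bb /esym e]|y [n _ Bn]]; last first.
    exists (y + n%:~R) => //; exact: to_circle_shift.
  have : to_circle b = to_circle y by [].
  by move=> /to_circle_eq/circle_relP[n en]; exists n => //=; rewrite -en.
apply: bigcup_open => n _; apply: open_comp => // y _.
by apply: (@cvgD _ _ _ (nbhs y)); [exact: cvg_id|exact: cvg_cst].
Qed.

(** The projections being open, so is their product, which is then a quotient
    map: continuity can be tested on periodic functions. *)
Lemma continuous_lift (f : phase_space R d -> R) :
  continuous (fun p : 'rV[R]_d * R * 'rV[R]_d =>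
    f (to_torus p.1.1, to_circle p.1.2, p.2)) ->
  continuous f.
Proof.
move=> cf [[X T] z] A fA.
rewrite -(of_torusK X) -(of_circleK T) in fA *.
have := cf (of_torus X, of_circle T, z) A fA.
move=> [/= [B C] /= [[[B1 B2] /= [nB1 nB2] sB] nC] sBC].
exists ((@to_torus R d @` B1) `*` (@to_circle R @` B2), C) => /=.
  split=> //; exists (@to_torus R d @` B1, @to_circle R @` B2) => //=.
  by split; [exact: to_torus_open|exact: to_circle_open].
move=> [[X' T'] z'] [/= [[x B1x <-] [t B2t <-]] Cz].
by apply: (sBC (x, t, z')); split => //=; apply: sB.
Qed.

Lemma torus_compact : compact [set: torus R d].
Proof.
pose B := [set x : 'rV[R]_d | `|x| <= 1].
have cB : compact B.
  apply: bounded_closed_compact.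
    exists 1; split; first exact: num_real.
    by move=> y My z /= zM; rewrite (le_trans zM) // ltW.
  apply: (@closed_comp _ _ (fun z : 'rV[R]_d => `|z|) [set x | x <= 1]).
    by move=> z _; exact: norm_continuous.
  exact: closed_le.
suff -> : [set: torus R d] = @to_torus R d @` B.
  apply: continuous_compact => //; apply: continuous_subspaceT.
  exact: pi_continuous.
apply/esym/seteqP; split=> // X _.
pose n : 'rV[int]_d := \row_j - Num.floor (of_torus X 0 j).
exists (of_torus X + map_mx intr n); last by rewrite to_torus_shift of_torusK.
apply: norm_row_le => // j; rewrite !mxE.
have h1 := floor_le (of_torus X 0 j); have h2 := floorD1_gt (of_torus X 0 j).
rewrite intrD1 in h2; rewrite rmorphN /= ler_norml; apply/andP; lra.
Qed.

Lemma circle_compact : compact [set: circle R].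
Proof.
suff -> : [set: circle R] = @to_circle R @` `[0, 1].
  apply: continuous_compact; last exact: segment_compact.
  apply: continuous_subspaceT; exact: pi_continuous.
apply/esym/seteqP; split=> // T _.
exists (of_circle T + (- Num.floor (of_circle T))%:~R).
  rewrite /= in_itv /= rmorphN /=.
  have h1 := floor_le (of_circle T); have h2 := floorD1_gt (of_circle T).
  by rewrite intrD1 in h2; apply/andP; lra.
by rewrite to_circle_shift of_circleK.
Qed.

(** The tori are compact, so that only the velocity has to be confined. *)
Lemma compactly_supported_bounded (f : phase_space R d -> R) (M : R) :
  (forall z, f z != 0 -> `|z.2| <= M) -> compactly_supported f.
Proof.
move=> fM.
pose B := [set x : 'rV[R]_d | `|x| <= M].
have clB : closed B.
  apply: (@closed_comp _ _ (fun z : 'rV[R]_d => `|z|) [set x | x <= M]).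
    by move=> z _; exact: norm_continuous.
  exact: closed_le.
have cB : compact B.
  apply: bounded_closed_compact => //.
  exists M; split; first exact: num_real.
  by move=> y My z /= zM; rewrite (le_trans zM) // ltW.
have cS : compact ([set: torus R d] `*` [set: circle R] `*` B).
  apply: compact_setX => //; apply: compact_setX.
    exact: torus_compact.
  exact: circle_compact.
apply: subclosed_compact cS _; first exact: closed_closure.
have clS : closed ([set: torus R d] `*` [set: circle R] `*` B).
  have -> : [set: torus R d] `*` [set: circle R] `*` B = snd @^-1` B.
    by apply/seteqP; split=> [z []|z].
  by apply: closed_comp => // z _; exact: cvg_snd.
rewrite [X in _ `<=` X](closure_id _).1 //.
by apply: closure_subset => z /= fz; split=> //; exact: fM.
Qed.

(** A continuous 1-periodic function vanishing exactly at the integers. *)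
Definition sinsq (u : R) : R := sin (pi * u) ^+ 2.

Lemma sinsq_shift u (n : int) : sinsq (u + n%:~R) = sinsq u.
Proof.
have S v : sinsq (v + 1) = sinsq v.
  by rewrite /sinsq mulrDr mulr1 sinDpi sqrrN.
have SN (k : nat) v : sinsq (v + k%:R) = sinsq v.
  elim: k => [|k IH]; first by rewrite addr0.
  by rewrite mulrSr addrA S.
case: n => k; first exact: SN.
by rewrite NegzE mulrNz -[LHS](SN k.+1) -addrA addNr addr0.
Qed.

Lemma sinsq_ge0 u : 0 <= sinsq u.
Proof. exact: sqr_ge0. Qed.

Lemma sinsq0 : sinsq 0 = 0.
Proof. by rewrite /sinsq mulr0 sin0 expr0n. Qed.

Lemma sinsq_eq0 u : sinsq u = 0 -> u \is a Num.int.
Proof.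
pose w := u - (Num.floor u)%:~R.
rewrite -(subrK (Num.floor u)%:~R u) -/w sinsq_shift => /eqP.
have w0 : 0 <= w by rewrite subr_ge0 floor_le.
have w1 : w < 1 by rewrite ltrBlDr addrC -intrD1 floorD1_gt.
move: w0; rewrite le_eqVlt => /orP[/eqP <- _|w0].
  by rewrite add0r intr_int.
rewrite sqrf_eq0 gt_eqF // sin_gt0_pi // mulr_gt0 ?pi_gt0 //=.
by rewrite -[ltRHS]mulr1 ltr_pM2l ?pi_gt0.
Qed.

Lemma continuous_sinsq : continuous sinsq.
Proof.
move=> u; rewrite /sinsq; under eq_fun do rewrite expr2.
have c : sin (pi * v) @[v --> u] --> sin (pi * u).
  apply: continuous_comp; last exact: continuous_sin.
  by apply: cvgMr; exact: cvg_id.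
exact: cvgM.
Qed.

End Quotients.

(** * Cutoff functions on the phase space *)

Section Cutoffs.
Context (R : realType) (d : nat).
Implicit Types (Z C : phase_space R d).

(** Vanishes only at [C]: the first two terms are periodic, hence do not depend
    on the representatives. *)
Definition phase_gap C Z : R :=
  \sum_j sinsq (of_torus Z.1.1 0 j - of_torus C.1.1 0 j) +
        sinsq (of_circle Z.1.2 - of_circle C.1.2) + `|Z.2 - C.2|.

Definition bump C Z : R := Num.max 0 (1 - phase_gap C Z).

Lemma bump_ge0 C Z : 0 <= bump C Z.
Proof. by rewrite le_max lexx. Qed.

Lemma phase_gap_ge0 C Z : 0 <= phase_gap C Z.
Proof.
rewrite !addr_ge0 ?sinsq_ge0 //; apply: sumr_ge0 => j _; exact: sinsq_ge0.
Qed.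

Lemma bump_le1 C Z : bump C Z <= 1.
Proof. by rewrite ge_max ler01 lerBlDr lerDl phase_gap_ge0. Qed.

Lemma bump_center C : bump C C = 1.
Proof.
rewrite /bump /phase_gap !subrr normr0 sinsq0 !addr0 big1 ?subr0; last first.
  by move=> j _; rewrite subrr sinsq0.
by apply/max_idPr.
Qed.

Lemma bump_eq1 C Z : bump C Z = 1 -> Z = C.
Proof.
move=> b1.
have : phase_gap C Z = 0.
  have := phase_gap_ge0 C Z; move: b1; rewrite /bump /Num.max.
  by case: ifP => _ ? ?; lra.
have s0 : 0 <= \sum_j sinsq (of_torus Z.1.1 0 j - of_torus C.1.1 0 j).
  by apply: sumr_ge0 => j _; exact: sinsq_ge0.
have t0 := sinsq_ge0 (of_circle Z.1.2 - of_circle C.1.2).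
have z0 := normr_ge0 (Z.2 - C.2).
rewrite /phase_gap => D0.
have e1 : \sum_j sinsq (of_torus Z.1.1 0 j - of_torus C.1.1 0 j) = 0 by lra.
have e2 : sinsq (of_circle Z.1.2 - of_circle C.1.2) = 0 by lra.
have /normr0_eq0/eqP e3 : `|Z.2 - C.2| = 0 by lra.
case: Z C {b1 D0 s0 t0 z0} e1 e2 e3 => [[X T] z] [[X' T'] z'] /= e1 e2.
rewrite subr_eq0 => /eqP ->; congr (_, _, _).
  rewrite -(of_torusK X) -(of_torusK X'); apply/to_torus_eq/forallP => j.
  apply: sinsq_eq0; move/psumr_eq0P: e1; apply=> // i _; exact: sinsq_ge0.
rewrite -(of_circleK T) -(of_circleK T'); apply/to_circle_eq.
exact: sinsq_eq0.
Qed.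

Lemma bump_support C Z : bump C Z != 0 -> `|Z.2| <= `|C.2| + 1.
Proof.
move=> b0.
have h : `|Z.2 - C.2| <= 1.
  have s0 : 0 <= \sum_j sinsq (of_torus Z.1.1 0 j - of_torus C.1.1 0 j).
    by apply: sumr_ge0 => j _; exact: sinsq_ge0.
  have t0 := sinsq_ge0 (of_circle Z.1.2 - of_circle C.1.2).
  rewrite leNgt; apply: contra b0 => h; apply/eqP/max_idPl; rewrite /phase_gap; lra.
by rewrite -(subrK C.2 Z.2) (le_trans (ler_normD _ _)) // addrC lerD2l.
Qed.

Lemma continuous_bump C : continuous (bump C).
Proof.
apply: continuous_lift => p.
pose g (p : 'rV[R]_d * R * 'rV[R]_d) : R := Num.max 0
  (1 - (\sum_j sinsq (p.1.1 0 j - of_torus C.1.1 0 j) +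
        sinsq (p.1.2 - of_circle C.1.2) + `|p.2 - C.2|)).
have -> : (fun p : 'rV[R]_d * R * 'rV[R]_d =>
    bump C (to_torus p.1.1, to_circle p.1.2, p.2)) = g.
  apply/funext => q; rewrite /bump /phase_gap /g /=.
  have [n ->] := of_to_torus q.1.1; have [k ->] := of_to_circle q.1.2.
  congr (Num.max 0 (1 - (_ + _ + _))).
    by apply: eq_bigr => j _; rewrite !mxE addrAC sinsq_shift.
  by rewrite addrAC sinsq_shift.
have c11 : q.1.1 @[q --> p] --> p.1.1.
  by apply: (@cvg_comp _ _ _ fst fst (nbhs p) (nbhs p.1)); exact: cvg_fst.
have c12 : q.1.2 @[q --> p] --> p.1.2.
  by apply: (@cvg_comp _ _ _ fst snd (nbhs p) (nbhs p.1)); [exact: cvg_fst|exact: cvg_snd].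
have c2 : q.2 @[q --> p] --> p.2 by exact: cvg_snd.
apply: (@continuous_max _ (_ : topologicalType) (cst 0) (fun p : 'rV[R]_d * R * 'rV[R]_d => 
  1 - (\sum_j sinsq (p.1.1 0 j - of_torus C.1.1 0 j) +
        sinsq (p.1.2 - of_circle C.1.2) + `|p.2 - C.2|))); first exact: cvg_cst.
apply: (@cvgB _ _ _ (nbhs p)); first exact: cvg_cst.
apply: (@cvgD _ _ _ (nbhs p)); last first.
  apply: (@cvg_norm _ _ _ (nbhs p) _ (fun q => q.2 - C.2)).
  by apply: (@cvgB _ _ _ (nbhs p)); [exact: c2|exact: cvg_cst].
apply: (@cvgD _ _ _ (nbhs p)); last first.
  have c : (q.1.2 - of_circle C.1.2) @[q --> p] --> p.1.2 - of_circle C.1.2.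
    by apply: (@cvgB _ _ _ (nbhs p)); [exact: c12|exact: cvg_cst].

  exact: (cvg_comp _ _ c (@continuous_sinsq R _)).
elim: (index_enum _) => [|j s IH].
  by under eq_fun do rewrite big_nil; rewrite big_nil; exact: cvg_cst.
under eq_fun do rewrite big_cons.
rewrite big_cons; apply: (@cvgD _ _ _ (nbhs p)) => //.
have c0 : (fun q : 'rV[R]_d * R * 'rV[R]_d => q.1.1 0 j) @ p --> p.1.1 0 j.
  exact: (cvg_comp _ _ c11 (@coord_continuous R 1 d 0 j p.1.1)).
have c : (fun q : 'rV[R]_d * R * 'rV[R]_d => q.1.1 0 j - of_torus C.1.1 0 j) @ p -->
    p.1.1 0 j - of_torus C.1.1 0 j.
  by apply: (@cvgB _ _ _ (nbhs p)); [exact: c0|exact: cvg_cst].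
exact: (cvg_comp _ _ c (@continuous_sinsq R _)).
Qed.

(** A maximum of bumps.  That the value one is attained only on [s] lets an
    integral equal to one confine a probability measure to [s]. *)
Lemma cutoff_exists (s : seq (phase_space R d)) : exists psi : phase_space R d -> R,
  [/\ continuous psi, (exists M : R, forall Z, psi Z != 0 -> `|Z.2| <= M),
      forall Z, 0 <= psi Z <= 1 & forall Z, psi Z = 1 <-> Z \in s].
Proof.
elim: s => [|C s [psi [cpsi [M hM] psi01 psi1]]].
  exists (cst 0); split; first exact: cst_continuous.
  - by exists 0 => Z; rewrite eqxx.
  - by move=> Z; rewrite lexx ler01.
  - by move=> Z; split => // /eqP; rewrite eq_sym oner_eq0.
exists (fun Z => Num.max (bump C Z) (psi Z)); split.
- move=> Z; apply: continuous_max; [exact: continuous_bump|exact: cpsi].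
- exists (Num.max (`|C.2| + 1) M) => Z; rewrite le_max.
  have [b0|b0] := eqVneq (bump C Z) 0; last by rewrite bump_support.
  have [p0|p0] := eqVneq (psi Z) 0; last by rewrite hM // orbT.
  by rewrite b0 p0 maxxx eqxx.
- move=> Z; have /andP[p0 p1] := psi01 Z.
  by rewrite le_max bump_ge0 ge_max bump_le1.
- move=> Z; rewrite inE; split=> [|/orP[/eqP ->|/psi1 p1]].
  + rewrite /Num.max; case: ifP => _ e; first by apply/orP; right; apply/psi1.
    by apply/orP; left; apply/eqP; exact: bump_eq1.
  + by rewrite bump_center; apply/max_idPl; have /andP[] := psi01 C.
  + by rewrite p1; apply/max_idPr; exact: bump_le1.
Qed.

Lemma compactly_supported_mul (f psi : phase_space R d -> R) (M : R) :
  (forall Z, psi Z != 0 -> `|Z.2| <= M) -> compactly_supported (fun Z => f Z * psi Z).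
Proof.
move=> hM; apply: (@compactly_supported_bounded _ _ _ M) => Z fp.
by apply: hM; apply: contra fp => /eqP ->; rewrite mulr0.
Qed.

Lemma compactly_supported_bounded_fun (f : phase_space R d -> R) :
  continuous f -> compactly_supported f -> bounded_fun f.
Proof.
move=> cf sf.
have : compact (f @` closure [set z | f z != 0]).
  by apply: continuous_compact => //; exact: continuous_subspaceT.
move=> /compact_bounded [M [Mr hM]].
exists (Num.max 0 M); split; first by rewrite num_real.
move=> y My z _ /=.
have [->|fz] := eqVneq (f z) 0.
  by rewrite normr0 (le_trans _ (ltW My)) // le_max lexx.
apply: (hM y); first by rewrite (le_lt_trans _ My) // le_max lexx orbT.
by exists z => //; exact: subset_closure.
Qed.

Variables (N K : nat) (L : 'rV[R]_d * R * 'rV[R]_d -> R) (c : 'rV[R]_d).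
Hypotheses (N_gt0 : (0 < N)%N) (K_gt0 : (0 < K)%N) (hL : Lagrangian_hyps L).

Lemma phase_pt_shift (m n : 'rV[int]_d) k z (zeta : 'rV[R]_d) :
  phase_pt N K (m + (N.*2)%:Z *: n) (k + (K.*2)%:Z * z) zeta = phase_pt N K m k zeta.
Proof.
by rewrite /phase_pt xg_shift // tg_shift // to_torus_shift to_circle_shift.
Qed.

Definition running_cost Z : R :=
  Lc L c (of_torus Z.1.1) (of_circle Z.1.2 - tau R K) Z.2.

(** The integrand of the action is built from chosen representatives; by
    periodicity it is the expected function of position and time. *)
Lemma running_cost_lift (p : 'rV[R]_d * R * 'rV[R]_d) :
  running_cost (to_torus p.1.1, to_circle p.1.2, p.2) =
  Lc L c p.1.1 (p.1.2 - tau R K) p.2.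
Proof.
rewrite /running_cost /Lc /=.
have [n ->] := of_to_torus p.1.1; have [k ->] := of_to_circle p.1.2.
by rewrite addrAC L_lattice.
Qed.

Lemma running_cost_pt m k zeta : running_cost (phase_pt N K m (k + 1) zeta) =
  Lc L c (xg R N m) (tg R K k) zeta.
Proof.
have := running_cost_lift (xg R N m, tg R K (k + 1), zeta) => /= ->.
by rewrite /tg rmorphD /= mulrDr mulr1 addrK.
Qed.

Lemma continuous_running_cost : continuous running_cost.
Proof.
apply: continuous_lift => p.
under eq_fun do rewrite running_cost_lift.
rewrite /Lc.
have c11 : q.1.1 @[q --> p] --> p.1.1.
  by apply: (@cvg_comp _ _ _ fst fst (nbhs p) (nbhs p.1)); exact: cvg_fst.
have c12 : q.1.2 @[q --> p] --> p.1.2.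
  by apply: (@cvg_comp _ _ _ fst snd (nbhs p) (nbhs p.1)); [exact: cvg_fst|exact: cvg_snd].
have c2 : q.2 @[q --> p] --> p.2 by exact: cvg_snd.
apply: (@cvgB _ _ _ (nbhs p)); last first.
  exact: (cvg_comp _ _ c2 (@continuous_dotp R d c p.2)).
have c3 : (q.1.2 - tau R K) @[q --> p] --> p.1.2 - tau R K.
  by apply: (@cvgB _ _ _ (nbhs p)); [exact: c12|exact: cvg_cst].
have c4 : (fun q : 'rV[R]_d * R * 'rV[R]_d => (q.1.1, q.1.2 - tau R K)) @ p -->
    (p.1.1, p.1.2 - tau R K) by exact: cvg_pair c11 c3.
have c5 : (fun q : 'rV[R]_d * R * 'rV[R]_d => (q.1.1, q.1.2 - tau R K, q.2)) @ p -->
    (p.1.1, p.1.2 - tau R K, p.2) by exact: cvg_pair c4 c2.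
exact: (cvg_comp _ _ c5 ((L_C2 hL).1 _)).
Qed.

End Cutoffs.

(** * Finitely supported measures *)

Section FiniteMeasures.
Context (R : realType) (dsp : measure_display) (T : measurableType dsp).
Variables (n : nat) (w : nat -> {nonneg R}) (pt : nat -> T).
Hypothesis w_sum : \sum_(k < n) (w k)%:num = 1.

Definition atomic_measure : set T -> \bar R :=
  msum (fun k => mscale (w k) \d_(pt k)) n.

HB.instance Definition _ := Measure.on atomic_measure.

Lemma atomic_measure_setT : atomic_measure [set: T] = 1%E.
Proof.
rewrite /atomic_measure /msum -w_sum -sumEFin; apply: eq_bigr => k _.
by rewrite /mscale -[RHS]mule1 -(diracT R (pt k)).
Qed.

HB.instance Definition _ :=
  @Measure_isProbability.Build _ _ R atomic_measure atomic_measure_setT.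

Definition atomic_probability : probability T R := atomic_measure.

Lemma ge0_integral_atomic (f : T -> \bar R) : measurable_fun setT f ->
  (forall x, 0 <= f x)%E ->
  (\int[atomic_probability]_x f x = \sum_(k < n) (w k)%:num%:E * f (pt k))%E.
Proof.
move=> mf f0.
rewrite /atomic_probability /atomic_measure /= ge0_integral_measure_sum //.
apply: eq_bigr => k _.
by rewrite ge0_integral_mscale //= integral_dirac // diracT mul1e.
Qed.

Lemma integral_atomic (f : T -> R) : measurable_fun setT f ->
  (\int[atomic_probability]_x (f x)%:E = (\sum_(k < n) (w k)%:num * f (pt k))%:E)%E.
Proof.
move=> mf.
have mF : measurable_fun setT (EFin \o f) by exact/measurable_EFinP.
rewrite integralE !ge0_integral_atomic //; last 2 first.
  - exact: measurable_funeneg.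
  - exact: measurable_funepos.
have p (x y : R) : (x%:E * maxe y%:E 0 = (x * Num.max y 0)%:E)%E.
  by rewrite -EFin_max.
under eq_bigr do rewrite funeposE p.
under [X in (_ - X)%E]eq_bigr do rewrite funenegE -EFinN p.
rewrite !sumEFin -EFinB -sumrB; congr (_%:E); apply: eq_bigr => k _.
rewrite -mulrBr; congr (_ * _).
by rewrite /Num.max; case: ifP; case: ifP; lra.
Qed.

End FiniteMeasures.

Section FiniteProbability.
Context (R : realType) (dsp : measure_display) (T : measurableType dsp).

Lemma finite_probability_exists (I : finType) (w : I -> R) (pt : I -> T) :
  (forall e, 0 <= w e) -> \sum_e w e = 1 ->
  exists mu : probability T R, forall f : T -> R, measurable_fun setT f ->
    (\int[mu]_x (f x)%:E = (\sum_e w e * f (pt e))%:E)%E.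
Proof.
move=> w0 w1.
have [e0 _|noI] := pickP (predT : pred I); last first.
  by move: w1; rewrite big1 => [/eqP|e]; [rewrite eq_sym oner_eq0|have := noI e].
pose idx k := nth e0 (enum I) k.
pose w' k : {nonneg R} := NngNum (w0 (idx k)).
have sumE (F : I -> R) : \sum_(k < #|I|) F (idx k) = \sum_e F e.
  by rewrite -(big_mkord xpredT (fun k => F (idx k))) cardE
     -(big_nth e0 xpredT F) big_enum.
have w'1 : \sum_(k < #|I|) (w' k)%:num = 1 by rewrite (sumE w).
exists (atomic_probability (pt \o idx) w'1) => f mf.
by rewrite integral_atomic // -(sumE (fun e => w e * f (pt e))).
Qed.

End FiniteProbability.

Section Borel.
Context (R : realType) (d : nat).
Implicit Types (mu : probability (Borel_phase R d) R) (f psi : phase_space R d -> R).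

Lemma continuous_measurable f : continuous f ->
  measurable_fun [set: Borel_phase R d] (f : Borel_phase R d -> R).
Proof.
move=> cf; apply: (measurability _ (RGenOInfty.measurableE R)).
move=> _ [_ [x ->] <-]; rewrite setTI; apply: sub_sigma_algebra.
by move/continuousP: cf; apply; exact: interval_open.
Qed.

Lemma open_measurable_phase (U : set (phase_space R d)) : open U ->
  measurable (U : set (Borel_phase R d)).
Proof. by move=> oU; exact: sub_sigma_algebra. Qed.

(** The nonnegative function [1 - psi] has integral zero. *)
Lemma cutoff_full mu psi : continuous psi -> (forall Z, 0 <= psi Z <= 1) ->
  (\int[mu]_z (psi z)%:E = 1)%E ->
  {ae mu, forall z, [set: Borel_phase R d] z -> psi z = 1}.
Proof.
move=> cpsi psi01 i1.
have m1 : measurable_fun [set: Borel_phase R d]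
    (fun z : Borel_phase R d => (psi z)%:E).
  by apply/measurable_EFinP; exact: continuous_measurable.
have m2 : measurable_fun [set: Borel_phase R d]
    (fun z : Borel_phase R d => (1 - psi z)%:E).
  apply/measurable_EFinP; apply: (@continuous_measurable (fun z => 1 - psi z)).
  by move=> z; apply: (@cvgB _ _ _ (nbhs z)); [exact: cvg_cst|exact: cpsi].
have p0 z : (0 <= (psi z)%:E)%E by rewrite lee_fin; have /andP[] := psi01 z.
have q0 z : (0 <= (1 - psi z)%:E)%E.
  by rewrite lee_fin subr_ge0; have /andP[] := psi01 z.
have i0 : (\int[mu]_z (1 - psi z)%:E = 0)%E.
  have := @ge0_integralD _ (Borel_phase R d) R mu setT measurableT
    (fun z => (psi z)%:E) (fun z => (1 - psi z)%:E) (fun z _ => p0 z) m1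
    (fun z _ => q0 z) m2.
  rewrite i1.
  under eq_integral do rewrite -EFinD addrC subrK.
  rewrite integral_cst //= mul1e probability_setT => /esym.
  have : (0 <= \int[mu]_z (1 - psi z)%:E)%E by apply: integral_ge0.
  case: (\int[mu]_z (1 - psi z)%:E)%E => [x| |] //= _ [].
  by rewrite -[X in _ = X]addr0 => /addrI ->.
have := (@ae_eq_integral_abs _ (Borel_phase R d) R mu setT measurableT
  (fun z => (1 - psi z)%:E) m2).1.
under eq_integral do rewrite gee0_abs //.
move=> /(_ i0); apply: filterS => z h zT.
by have [] := h zT; lra.
Qed.

(** The points where [psi] differs from one form a null open set. *)
Lemma msupport_cutoff mu psi : continuous psi -> (forall Z, 0 <= psi Z <= 1) ->
  (\int[mu]_z (psi z)%:E = 1)%E -> forall z, msupport mu z -> psi z = 1.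
Proof.
move=> cpsi psi01 i1 z sz; apply: contrapT => pz.
pose U := [set z | psi z <> 1].
have oU : open U.
  have -> : U = psi @^-1` [set~ 1] by [].
  by apply: open_comp => [y _|]; [exact: cpsi|rewrite openC; exact: closed_eq].
have := sz U oU pz.
have [A [mA A0 UA]] := cutoff_full cpsi psi01 i1.
suff -> : mu U = 0%E by rewrite ltxx.
apply: (subset_measure0 _ _ _ A0) => //.
- exact: open_measurable_phase.
- by move=> y Uy; apply: UA => /= /(_ I).
Qed.

Lemma integral_cutoff mu psi f : continuous psi -> (forall Z, 0 <= psi Z <= 1) ->
  (\int[mu]_z (psi z)%:E = 1)%E -> continuous f ->
  (\int[mu]_z (f z)%:E = \int[mu]_z (f z * psi z)%:E)%E.
Proof.
move=> cpsi psi01 i1 cf.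
apply: ae_eq_integral => //.
- by apply/measurable_EFinP; exact: continuous_measurable.
- apply/measurable_EFinP; apply: (@continuous_measurable (fun z => f z * psi z)).
  by move=> z; apply: (@cvgM _ _ (nbhs z)); [exact: cf|exact: cpsi].
- apply: filterS (cutoff_full cpsi psi01 i1) => z h zT.
  by rewrite h // mulr1.
Qed.

End Borel.

Section Subsequences.
Context (R : realType).

(** Extraction of successive subsequences, one index at a time. *)
Lemma bolzano_weierstrass_finite (I : finType) (u : nat -> I -> R) :
  (forall n e, 0 <= u n e <= 1) ->
  exists s : nat -> nat, (forall i j, (i < j)%N -> (s i < s j)%N) /\
    forall e, cvgn (fun n => u (s n) e).
Proof.
move=> u01.
suff [s [hs cs]] : exists s : nat -> nat,
    (forall i j, (i < j)%N -> (s i < s j)%N) /\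
    forall e, e \in enum I -> cvgn (fun n => u (s n) e).
  by exists s; split => // e; apply: cs; rewrite mem_enum.
elim: (enum I) => [|a r [s [hs cs]]]; first by exists id.
have bu : bounded_fun (fun n => u (s n) a).
  exists 1; split; first exact: num_real.
  move=> y y1 n _ /=; have /andP[h0 h1] := u01 (s n) a.
  by rewrite ger0_norm // (le_trans h1) // ltW.
have [f finc cf] := bolzano_weierstrass bu.
have f_lt i j : (i < j)%N -> (f i < f j)%N.
  by move=> ij; have := leW_mono finc i j; rewrite /Order.lt /= => ->.
exists (s \o f); split; first by move=> i j ij; apply/hs/f_lt.
move=> e; rewrite inE => /orP[/eqP ->|er]; first exact: cf.
have cse := cs e er.
apply/cvg_ex; exists (limn (fun n => u (s n) e)).
have foo : f n @[n --> \oo] --> \oo.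
  apply/cvgnyPge => A; near=> n.
  apply: (@leq_trans n); first by near: n; exact: nbhs_infty_ge.
  by elim: (n) => [//|k IH]; exact: leq_ltn_trans IH (f_lt _ _ (ltnSn k)).
exact: (cvg_comp _ _ foo cse).
Unshelve. all: end_near. Qed.

Lemma cvg_weighted_sum (I : finType) (u : nat -> I -> R) (w a : I -> R) :
  (forall i, u n i @[n --> \oo] --> w i) ->
  (\sum_i u n i * a i) @[n --> \oo] --> \sum_i w i * a i.
Proof.
move=> uw; elim: (index_enum _) => [|i s IH].
  under eq_fun do rewrite big_nil; rewrite big_nil; exact: cvg_cst.
under eq_fun do rewrite big_cons; rewrite big_cons.
by apply: cvgD => //; apply: cvgM; [exact: uw|exact: cvg_cst].
Qed.

End Subsequences.

(** * Average cost along the walk *)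

Section WalkCost.
Context (R : realType) (d N K : nat).
Hypotheses (d_gt0 : (0 < d)%N) (N_gt0 : (0 < N)%N) (K_gt0 : (0 < K)%N).
Variables (L : 'rV[R]_d * R * 'rV[R]_d -> R) (r : R) (c : 'rV[R]_d).
Hypotheses (hL : Lagrangian_hyps L).
Variables (n0 : 'rV[int]_d) (xi : 'rV[int]_d -> int -> 'rV[R]_d).
Hypotheses (n0_odd : ~~ ievenx n0) (xi_adm : admissible N K xi).
Local Notation Hbar := (effective_H N K L r c).
Local Notation cell := (cell_index d N K).
Local Notation mean := (walk_mean N K n0 xi).
Local Notation wt := (weight N_gt0 K_gt0 n0 xi).
Implicit Types (m : 'rV[int]_d) (k : int) (e : cell).

Definition control_pt e : phase_space R d :=
  phase_pt N K (cell_m e) (cell_k e) (xi (cell_m e) (cell_k e)).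

Lemma phase_pt_invariant (f : phase_space R d -> R) :
  lattice_invariant N K (fun m k => f (phase_pt N K m k (xi m k))).
Proof.
move=> m k n z tm; rewrite (lattice_periodic xi_adm.1) //.
by rewrite phase_pt_shift.
Qed.

Section GivenSolution.
Variable v : 'rV[int]_d -> int -> R.
Hypothesis vP : cell_solution N K L r c v.

Definition control_gap m k : R := gap N K L c v m (k - 1) (xi m k).

Lemma control_gap_ge0 m k : 0 <= control_gap m k.
Proof. exact: gap_ge0. Qed.

Lemma control_gap_invariant : lattice_invariant N K control_gap.
Proof.
move=> m k n z tm; rewrite /control_gap (lattice_periodic xi_adm.1) //.
have gm : grid m (k - 1) by rewrite -tgrid_step subrK.
rewrite addrAC /gap (cell_grad_periodic vP) // xg_shift // tg_shift //.
by rewrite Ham_lattice // L_lattice.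
Qed.

(** Each step exchanges the mean of [v] before and after it by the dynamic
    programming identity [cell_control]. *)
Lemma walk_cost_telescope (l : nat) :
  \sum_(i < l) tau R K * mean i (fun m =>
     running_cost K L c (phase_pt N K m (- i%:Z) (xi m (- i%:Z)))) =
  v n0 0 - mean l (v ^~ (- l%:Z)) - tau R K * l%:R * Hbar +
  \sum_(i < l) tau R K * mean i (control_gap ^~ (- i%:Z)).
Proof.
elim: l => [|l IH].
  by rewrite !big_ord0 oppr0 mulr0 mul0r subr0 addr0 subrr.
rewrite !big_ord_recr /= {}IH.
set C := mean l (fun m => running_cost _ _ _ _).
set G := mean l (control_gap ^~ _).
suff -> : mean l (transition N K xi (- l%:Z) (v ^~ (- l.+1%:Z))) =
   mean l (v ^~ (- l%:Z)) + - tau R K * C + - (tau R K * Hbar) * mean l (cst 1)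
   + tau R K * G.
  by rewrite walk_mean_cst // -natr1; ring.
rewrite /C /G -!walk_meanD.
apply: (eq_walk_mean d_gt0 N_gt0 K_gt0 n0_odd xi_adm) => m tm.
have ek : - l.+1%:Z = - l%:Z - 1 by lia.
have gm : grid m (- l%:Z - 1) by rewrite -tgrid_step subrK.
rewrite /transition ek (cell_control N_gt0 K_gt0 vP) // subrK.
have -> : running_cost K L c (phase_pt N K m (- l%:Z) (xi m (- l%:Z))) =
    Lc L c (xg R N m) (tg R K (- l%:Z - 1)) (xi m (- l%:Z)).
  by rewrite -running_cost_pt // subrK.
by rewrite /control_gap /=; ring.
Qed.

Lemma cell_solution_bounded : exists C, forall m k, tgrid m k -> `|v m k| <= C.
Proof.
exists (\sum_(e : cell) `|v (cell_m e) (cell_k e)|) => m k tm.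
have [pv _ _] := vP.
rewrite -(invariant_cell_of N_gt0 K_gt0 (lattice_periodic pv) tm).
by rewrite (bigD1 (cell_of N_gt0 K_gt0 m k)) //= lerDl; apply: sumr_ge0.
Qed.

(** The boundary terms of the telescoping sum are bounded, as a periodic [v] is;
    dividing by the elapsed time makes them vanish. *)
Lemma walk_cost_identity : exists C : R, forall l : nat, (0 < l)%N ->
  `|\sum_e wt l e * running_cost K L c (control_pt e) -
    (- Hbar + \sum_e wt l e * control_gap (cell_m e) (cell_k e))| <= C / l%:R.
Proof.
have [C hC] := cell_solution_bounded.
have t0 := @tau_gt0 R K K_gt0.
exists ((C + C) / tau R K) => l l0.
have lR : 0 < l%:R :> R by rewrite ltr0n.
rewrite -(occupation_sum d_gt0 N_gt0 K_gt0 n0_odd xi_adm l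
  (phase_pt_invariant (running_cost K L c))).
rewrite -(occupation_sum d_gt0 N_gt0 K_gt0 n0_odd xi_adm l control_gap_invariant).
have := walk_cost_telescope l; rewrite -!mulr_sumr.
set A := \sum_(i < l) mean i _; set B := \sum_(i < l) mean i _.
set D := mean l _ => e.
have -> : l%:R^-1 * A - (- Hbar + l%:R^-1 * B) = (v n0 0 - D) / (tau R K * l%:R).
  have -> : A = (v n0 0 - D - tau R K * l%:R * Hbar + tau R K * B) / tau R K.
    by rewrite -e mulrC mulKf // gt_eqF.
  by field; rewrite !gt_eqF.
rewrite normrM normfV (gtr0_norm (mulr_gt0 t0 lR)) invfM mulrA.
do 2!(apply: ler_wpM2r; first by rewrite invr_ge0 ltW).
have hv : `|v n0 0| <= C by apply: hC; rewrite tgrid0.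
have hD : `|D| <= C.
  rewrite ler_norml; apply/andP; split.
    rewrite -[leLHS](walk_mean_cst K d_gt0 N_gt0 n0 xi (- C) l).
    apply: (walk_mean_le d_gt0 N_gt0 K_gt0 n0_odd xi_adm) => m tm /=.
    by have := hC _ _ tm; rewrite ler_norml => /andP[].
  rewrite -[leRHS](walk_mean_cst K d_gt0 N_gt0 n0 xi C l).
  apply: (walk_mean_le d_gt0 N_gt0 K_gt0 n0_odd xi_adm) => m tm /=.
  by have := hC _ _ tm; rewrite ler_norml => /andP[].
by rewrite (le_trans (ler_normB _ _)) // lerD.
Qed.

End GivenSolution.

Lemma weight_le1 l e : (0 < l)%N -> wt l e <= 1.
Proof.
move=> l0; rewrite -(weight_sum d_gt0 N_gt0 K_gt0 n0_odd xi_adm l0).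
rewrite (bigD1 e) //= lerDl; apply: sumr_ge0 => e' _.
exact: (weight_ge0 d_gt0 N_gt0 K_gt0 n0_odd xi_adm).
Qed.

(** The successor discards the average over an empty walk. *)
Record limit_weight (s : nat -> nat) (w : cell -> R) : Prop := {
  limit_weight_incr : forall i j, (i < j)%N -> (s i < s j)%N;
  limit_weight_cvg : forall e, wt (s n).+1 e @[n --> \oo] --> w e }.

Section LimitWeight.
Variables (s : nat -> nat) (w : cell -> R).
Hypothesis sw : limit_weight s w.

Lemma limit_weight_ge0 e : 0 <= w e.
Proof.
rewrite -(cvg_lim (@Rhausdorff R) (@limit_weight_cvg s w sw e)).
apply: limr_ge; first by apply/cvg_ex; exists (w e); exact: (@limit_weight_cvg s w sw).
by apply: nearW => n; exact: (weight_ge0 d_gt0 N_gt0 K_gt0 n0_odd xi_adm).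
Qed.

Lemma limit_weight_sum : \sum_e w e = 1.
Proof.
have := cvg_weighted_sum (a := fun _ => 1) (@limit_weight_cvg s w sw).
under eq_fun => n do
  (under eq_bigr do rewrite mulr1; rewrite (weight_sum d_gt0 N_gt0 K_gt0 n0_odd xi_adm) //).
move=> h; have := cvg_lim (@Rhausdorff R) h.
rewrite lim_cst //; under eq_bigr do rewrite mulr1.
by move=> <-.
Qed.

Lemma limit_weight_tgrid e : ~~ tgrid (cell_m e) (cell_k e) -> w e = 0.
Proof.
move=> te; rewrite -(cvg_lim (@Rhausdorff R) (@limit_weight_cvg s w sw e)).
under eq_fun do rewrite (weight_tgrid d_gt0 N_gt0 K_gt0 n0_odd xi_adm) //.
by rewrite lim_cst.
Qed.

Lemma limit_weight_cost v : cell_solution N K L r c v ->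
  \sum_e w e * running_cost K L c (control_pt e) =
  - Hbar + \sum_e w e * control_gap v (cell_m e) (cell_k e).
Proof.
move=> vP; have [C hC] := walk_cost_identity vP.
pose u n := \sum_e wt (s n).+1 e * running_cost K L c (control_pt e) -
    (- Hbar + \sum_e wt (s n).+1 e * control_gap v (cell_m e) (cell_k e)).
have c1 : u n @[n --> \oo] --> \sum_e w e * running_cost K L c (control_pt e) -
  (- Hbar + \sum_e w e * control_gap v (cell_m e) (cell_k e)).
  apply: cvgB; first exact: (cvg_weighted_sum (@limit_weight_cvg s w sw)).
  apply: cvgD; first exact: cvg_cst.
  exact: (cvg_weighted_sum (a := fun e => control_gap v (cell_m e) (cell_k e)) (@limit_weight_cvg s w sw)).
have s_ge n : (n <= s n)%N.
  by elim: n => [//|n IH]; exact: leq_ltn_trans IH (@limit_weight_incr s w sw _ _ (ltnSn n)).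
have c2 : u n @[n --> \oo] --> 0.
  have ch : C * harmonic n @[n --> \oo] --> 0.
    by rewrite -(mulr0 C); apply: cvgM; [exact: cvg_cst|exact: cvg_harmonic].
  apply/norm_cvg0P; apply: (@squeeze_cvgr _ _ _ _ (cst 0) (fun n => C * harmonic n)) => //.
    near=> n; rewrite normr_ge0 /=.
    apply: (le_trans (hC (s n).+1 (ltn0Sn _))).
    have C0 : 0 <= C.
      have := hC 1 (ltn0Sn _); rewrite divr1; exact: le_trans (normr_ge0 _).
    rewrite ler_wpM2l // /harmonic /= lef_pV2 ?posrE ?ltr0n // ler_nat.
    by rewrite ltnS.
  exact: cvg_cst.
apply/eqP; rewrite -subr_eq0; apply/eqP.
by rewrite -(cvg_lim (@Rhausdorff R) c1) (cvg_lim (@Rhausdorff R) c2).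
Unshelve. all: end_near. Qed.

End LimitWeight.

Lemma limit_weight_exists (t : nat -> nat) :
  (forall i j, (i < j)%N -> (t i < t j)%N) ->
  exists q w, limit_weight (t \o q) w /\ forall i j, (i < j)%N -> (q i < q j)%N.
Proof.
move=> ht.
have w01 n e : 0 <= wt (t n).+1 e <= 1.
  rewrite weight_le1 // andbT.
  exact: (weight_ge0 d_gt0 N_gt0 K_gt0 n0_odd xi_adm).
have [q [hq cq]] := bolzano_weierstrass_finite w01.
exists q, (fun e => limn (fun n => wt (t (q n)).+1 e)); split => //.
by split => [i j ij|e]; [exact/ht/hq|exact: cq].
Qed.

End WalkCost.

(** * Limits of occupation measures *)

Section LimitMeasures.
Context (R : realType) (d N K : nat).
Hypotheses (d_gt0 : (0 < d)%N) (N_gt0 : (0 < N)%N) (K_gt0 : (0 < K)%N).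
Variables (L : 'rV[R]_d * R * 'rV[R]_d -> R) (r : R) (c : 'rV[R]_d).
Hypotheses (hL : Lagrangian_hyps L).
Variables (n0 : 'rV[int]_d) (xi : 'rV[int]_d -> int -> 'rV[R]_d).
Hypotheses (n0_odd : ~~ ievenx n0) (xi_adm : admissible N K xi).
Local Notation Hbar := (effective_H N K L r c).
Local Notation cell := (cell_index d N K).
Local Notation wt := (weight N_gt0 K_gt0 n0 xi).
Local Notation pt := (control_pt xi).
Implicit Types (e : cell) (mu : probability (Borel_phase R d) R).

Definition represented mu (w : cell -> R) : Prop :=
  forall f : phase_space R d -> R, continuous f ->
    (\int[mu]_z (f z)%:E = (\sum_e w e * f (pt e))%:E)%E.

(** Against compactly supported functions the occupation measures are given by
    the weights, and so is the limit.  A cutoff equal to one on all control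
    points then has integral one in the limit as well: no mass has escaped, and
    multiplication by the cutoff extends the formula to all continuous [f]. *)
Lemma occupation_limit mu (mus : nat -> probability (Borel_phase R d) R) (s : nat -> nat) :
  (forall l, (0 < l)%N -> occupation_measure N K n0 xi l (mus l)) ->
  (forall i j, (i < j)%N -> (s i < s j)%N) -> weak_cvg (mus \o s) mu ->
  exists t w, limit_weight N_gt0 K_gt0 n0 xi t w /\ represented mu w.
Proof.
move=> hocc hs hw.
have s_gt0 n : (0 < s n.+1)%N by apply: leq_trans (hs 0%N n.+1 _).
pose t n := (s n.+1).-1.
have tS n : (t n).+1 = s n.+1 by rewrite prednK.
have ht i j : (i < j)%N -> (t i < t j)%N.
  by move=> ij; rewrite -ltnS !tS hs.
have [q [w [lw hq]]] := limit_weight_exists d_gt0 N_gt0 K_gt0 n0_odd xi_adm ht.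
exists (t \o q), w; split => //.
have q_ge n : (n <= q n)%N.
  by elim: n => [//|k IH]; exact: leq_ltn_trans IH (hq _ _ (ltnSn k)).
have qoo : (q n).+1 @[n --> \oo] --> \oo.
  apply/cvgnyPge => A; near=> n.
  apply: (@leq_trans n); first by near: n; exact: nbhs_infty_ge.
  exact: leqW.
have rep_c f : continuous f -> compactly_supported f ->
    (\int[mu]_z (f z)%:E = (\sum_e w e * f (pt e))%:E)%E.
  move=> cf sf.
  have c1 := cvg_comp _ _ qoo (hw f cf (compactly_supported_bounded_fun cf sf)).
  have c2 : (\sum_e wt (t (q n)).+1 e * f (pt e))%:E @[n --> \oo] -->
      (\sum_e w e * f (pt e))%:E.
    apply: cvg_EFin; first exact: nearW.
    exact: (cvg_weighted_sum (@limit_weight_cvg _ _ _ _ _ _ _ _ _ _ lw)).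
  have e1 : (fun n => (\sum_e wt (t (q n)).+1 e * f (pt e))%:E) =
      (fun n => \int[mus (s (q n).+1)]_z (f z)%:E)%E.
    apply/funext => n; rewrite hocc // -tS; congr EFin.
    rewrite (walk_expectation_occupation d_gt0 N_gt0 K_gt0 n0_odd xi_adm _
      (phase_pt_invariant N_gt0 K_gt0 xi_adm f)) //.
  rewrite e1 in c2.
  by rewrite -(cvg_lim (@ereal_hausdorff R) c1) -(cvg_lim (@ereal_hausdorff R) c2).
have [psi [cpsi [M hM] psi01 psi1]] := cutoff_exists [seq pt e | e <- enum cell].
have psi_pt e : psi (pt e) = 1 by apply/psi1/map_f; rewrite mem_enum.
have i1 : (\int[mu]_z (psi z)%:E = 1)%E.
  rewrite rep_c //; last exact: compactly_supported_bounded hM.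
  under eq_bigr do rewrite psi_pt mulr1.
  by rewrite (limit_weight_sum d_gt0 n0_odd xi_adm lw).
move=> f cf; rewrite (integral_cutoff cpsi psi01 i1 cf).
rewrite (rep_c (fun z => f z * psi z)).
- by under eq_bigr do rewrite psi_pt mulr1.
- by move=> z; apply: (@cvgM _ _ (nbhs z)); [exact: cf|exact: cpsi].
- exact: compactly_supported_mul hM.
Unshelve. all: end_near. Qed.

Section Represented.
Variables (t : nat -> nat) (w : cell -> R) (mu : probability (Borel_phase R d) R).
Hypotheses (lw : limit_weight N_gt0 K_gt0 n0 xi t w) (muw : represented mu w).
Variable v : 'rV[int]_d -> int -> R.
Hypothesis vP : cell_solution N K L r c v.
Local Notation gap_of := (control_gap N K L c xi v).

Lemma action_represented :
  action K L c mu = (- Hbar + \sum_e w e * gap_of (cell_m e) (cell_k e))%:E.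
Proof.
rewrite -(limit_weight_cost d_gt0 hL n0_odd xi_adm lw vP).
exact: (muw (@continuous_running_cost R d K L c hL)).
Qed.

Lemma mean_gap_ge0 : 0 <= \sum_e w e * gap_of (cell_m e) (cell_k e).
Proof.
apply: sumr_ge0 => e _; rewrite mulr_ge0 ?control_gap_ge0 //.
exact: (limit_weight_ge0 d_gt0 n0_odd xi_adm lw).
Qed.

(** Weights over points of positive gap must vanish, so a cutoff peaking only at
    the points of zero gap has integral one. *)
Lemma msupport_represented :
  \sum_e w e * gap_of (cell_m e) (cell_k e) = 0 ->
  forall z, msupport mu z -> exists m k, pr_tgrid N K m (k + 1) /\
    z = phase_pt N K m (k + 1) (Ham_p L (xg R N m) (tg R K k) (c + Dx N (v^~ k) m)).
Proof.
move=> g0 z sz.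
have w0 e := limit_weight_ge0 d_gt0 n0_odd xi_adm lw e.
pose good := [pred e : cell | tgrid (cell_m e) (cell_k e) &&
  (gap_of (cell_m e) (cell_k e) == 0)].
have [psi [cpsi [M hM] psi01 psi1]] := cutoff_exists [seq pt e | e <- enum good].
have i1 : (\int[mu]_z (psi z)%:E = 1)%E.
  rewrite muw //.
  suff -> : \sum_e w e * psi (pt e) = 1 by [].
  rewrite -(limit_weight_sum d_gt0 n0_odd xi_adm lw); apply: eq_bigr => e _.
  have [ge|nge] := boolP (good e).
    rewrite (psi1 (pt e)).2 ?mulr1 //.
    by apply: map_f; rewrite mem_enum.
  suff -> : w e = 0 by rewrite mul0r.
  move: nge; rewrite /= negb_and => /orP[te|ge].
    exact: (limit_weight_tgrid d_gt0 n0_odd xi_adm lw).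
  have /eqP : w e * gap_of (cell_m e) (cell_k e) = 0.
    apply: (psumr_eq0P _ g0) => // e' _.
    by rewrite mulr_ge0 // control_gap_ge0.
  by rewrite mulf_eq0 (negbTE ge) orbF => /eqP.
have /psi1/mapP[e] := msupport_cutoff cpsi psi01 i1 sz.
rewrite mem_enum => /andP[te /eqP ge] ->.
exists (cell_m e), (cell_k e - 1); rewrite subrK; split.
  split=> // [j|]; first by rewrite /cell_m mxE; move: (ltn_ord (e.1 j)); case: (e.1 j) => a /= _ aN; lia.
  by rewrite /cell_k; case: (e.2) => a /= aK; lia.
by rewrite /control_pt; congr phase_pt; exact: (gap_eq0 hL ge).
Qed.

End Represented.
End LimitMeasures.

(** * Optimal control and conclusion *)

Section OptimalControl.
Context (R : realType) (d N K : nat).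
Hypotheses (d_gt0 : (0 < d)%N) (N_gt0 : (0 < N)%N) (K_gt0 : (0 < K)%N).
Variables (L : 'rV[R]_d * R * 'rV[R]_d -> R) (r : R) (c : 'rV[R]_d).
Hypotheses (hL : Lagrangian_hyps L).
Variable n0 : 'rV[int]_d.
Hypothesis n0_odd : ~~ ievenx n0.
Variable v : 'rV[int]_d -> int -> R.
Hypothesis vP : cell_solution N K L r c v.
Hypothesis Hp_box : forall m k, grid m k -> forall j,
  - (d%:R * lam R N K)^-1 <=
    Ham_p L (xg R N m) (tg R K k) (c + Dx N (v^~ k) m) 0 j
  <= (d%:R * lam R N K)^-1.
Local Notation Hbar := (effective_H N K L r c).

Definition optimal_control (m : 'rV[int]_d) (k : int) : 'rV[R]_d :=
  Ham_p L (xg R N m) (tg R K (k - 1)) (c + Dx N (v^~ (k - 1)) m).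
Local Notation xi := optimal_control.
Local Notation pt := (control_pt xi).

Lemma optimal_admissible : admissible N K xi.
Proof.
have tg1 m k : tgrid m k -> grid m (k - 1) by rewrite -tgrid_step subrK.
split=> m k /tg1 gm; last exact: Hp_box.
have inv n z : xi (m + (N.*2)%:Z *: n) (k + (K.*2)%:Z * z) = xi m k.
  rewrite /xi addrAC (cell_grad_periodic vP) // xg_shift // tg_shift //.
  by rewrite /Ham_p Ham_lattice.
split=> [j|]; first by have := inv (ei j) 0; rewrite mulr0 addr0.
by have := inv 0 1; rewrite scaler0 addr0 mulr1.
Qed.

(** The control has zero gap at every grid point.  Its occupation measures are
    finite sums of Dirac masses at fixed points, so compactness of the weights
    alone provides a weak limit. *)
Lemma optimal_measure : exists2 mu : probability (Borel_phase R d) R,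
  Pdelta N K n0 mu & action K L c mu = (- Hbar)%:E.
Proof.
pose wt := weight N_gt0 K_gt0 n0 xi.
have adm := optimal_admissible.
have [q [w [lw hq]]] := limit_weight_exists d_gt0 N_gt0 K_gt0 n0_odd adm
  (fun i j (ij : (i < j)%N) => ij).
have measures l : exists mu : probability (Borel_phase R d) R, (0 < l)%N ->
    forall f : phase_space R d -> R, continuous f ->
    (\int[mu]_z (f z)%:E = (\sum_e wt l e * f (pt e))%:E)%E.
  have l0 : (0 < maxn l 1)%N by rewrite leq_max orbT.
  have [mu hmu] := @finite_probability_exists R _ (Borel_phase R d) _
    (wt (maxn l 1)) pt (weight_ge0 d_gt0 N_gt0 K_gt0 n0_odd adm _)
    (weight_sum d_gt0 N_gt0 K_gt0 n0_odd adm l0).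
  exists mu => lgt f cf; rewrite hmu; last exact: continuous_measurable.
  by rewrite (maxn_idPl lgt).
pose mus l := projT1 (cid (measures l)).
have musP l := projT2 (cid (measures l)); rewrite -/mus in musP.
have [mu hmu] := @finite_probability_exists R _ (Borel_phase R d) _ w pt
  (limit_weight_ge0 d_gt0 n0_odd adm lw) (limit_weight_sum d_gt0 n0_odd adm lw).
have muw : represented xi mu w.
  by move=> f cf; apply: hmu; exact: continuous_measurable.
exists mu; last first.
  rewrite (action_represented d_gt0 hL n0_odd adm lw muw vP) big1 ?addr0 // => e _.
  by rewrite /control_gap gap_optimal // mulr0.
exists xi => //; exists mus, (fun n => (q n).+1); split.
- move=> l l0 f cf sf; rewrite musP //; congr EFin.
  rewrite (walk_expectation_occupation d_gt0 N_gt0 K_gt0 n0_odd adm l0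
    (phase_pt_invariant N_gt0 K_gt0 adm f)) //.
- by move=> i j ij; rewrite ltnS; exact: hq.
- move=> f cf bf; rewrite muw //=.
  have -> : (fun n => \int[mus (q n).+1]_z (f z)%:E)%E =
      (fun n => (\sum_e wt (q n).+1 e * f (pt e))%:E).
    by apply/funext => n; rewrite musP.
  apply: cvg_EFin; first exact: nearW.
  exact: (cvg_weighted_sum (@limit_weight_cvg _ _ _ _ _ _ _ _ _ _ lw)).
Qed.

End OptimalControl.

Theorem theorem3p6 (R : realType) (d N K : nat)
  (L : 'rV[R]_d * R * 'rV[R]_d -> R) (P : set 'rV[R]_d) (r lam1 : R)
  (n0 : 'rV[int]_d)
  (d_gt0 : (0 < d)%N) (N_gt0 : (0 < N)%N) (K_gt0 : (0 < K)%N)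
  (hL : Lagrangian_hyps L)
  (P_compact : compact P) (P_convex : convex_set P)
  (r_gt0 : 0 < r)
  (lam1_gt0 : 0 < lam1) (lam_lt : lam R N K < lam1)
  (hstanding : standing N K L r P lam1)
  (n0_odd : ~~ ievenx n0)
  (c : 'rV[R]_d) (cP : P c) :
  [/\ ereal_inf (action K L c @` Pdelta N K n0) = (- effective_H N K L r c)%:E,
      (forall mu, minimizer N K L n0 c mu ->
         msupport mu `<=` Aubry_set N K L r c),
      Mather_set N K L n0 c `<=` Aubry_set N K L r c
    & Aubry_set N K L r c `<=` @control_box R d N K].
Proof.
have phi_X v : Xset N r v -> Xset N r (phi N K L v c K.*2).
  by move=> vX; have [] := hstanding c cP v vX.
have Hp_le v : Xset N r v -> forall m (k : nat), grid m k ->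
    `|Ham_p L (xg R N m) (tg R K k) (c + Dx N (phi N K L v c k) m)| <=
    (d%:R * lam1)^-1.
  by move=> vX; have [] := hstanding c cP v vX.
have fixed := effective_HP d_gt0 N_gt0 K_gt0 hL r_gt0 lam_lt phi_X Hp_le.
have [v vP] := cell_solution_exists d_gt0 N_gt0 K_gt0 hL fixed.
have Hp_box m k : grid m k -> forall j,
    - (d%:R * lam R N K)^-1 <=
      Ham_p L (xg R N m) (tg R K k) (c + Dx N (v^~ k) m) 0 j
    <= (d%:R * lam R N K)^-1.
  move=> gm j; rewrite -ler_norml (le_trans (ler_norm_coord _ _)) //.
  rewrite (le_trans (cell_Hp_bound d_gt0 K_gt0 hL vP Hp_le gm)) //.
  have l0 := @lam_gt0 R N K N_gt0 K_gt0.
  have d0 : 0 < d%:R :> R by rewrite ltr0n.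
  rewrite lef_pV2 ?posrE; [|exact: mulr_gt0|exact: mulr_gt0].
  by rewrite ler_wpM2l // ltW.
have [mu0 mu0P mu0A] := optimal_measure d_gt0 N_gt0 K_gt0 hL n0_odd vP Hp_box.
have rep (mu : probability (Borel_phase R d) R) : Pdelta N K n0 mu -> exists xi, admissible N K xi /\
    exists t w, limit_weight N_gt0 K_gt0 n0 xi t w /\ represented xi mu w.
  move=> [xi adm [mus [s [hocc hs hw]]]]; exists xi; split => //.
  exact: (occupation_limit d_gt0 N_gt0 K_gt0 n0_odd adm hocc hs hw).
have minsup mu : minimizer N K L n0 c mu -> msupport mu `<=` Aubry_set N K L r c.
  move=> [muP mumin] z sz v' v'P.
  have [xi [adm [t [w [lw muw]]]]] := rep mu muP.
  apply: (msupport_represented d_gt0 hL n0_odd adm lw muw _ sz).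
  have := mumin mu0 mu0P; rewrite mu0A.
  rewrite (action_represented d_gt0 hL n0_odd adm lw muw v'P) lee_fin gerDl.
  by move=> g0; apply/eqP; rewrite eq_le g0 (mean_gap_ge0 d_gt0 c hL n0_odd adm lw).
split=> //.
- apply/eqP; rewrite eq_le; apply/andP; split.
    by apply: ereal_inf_lbound; exists mu0.
  apply: le_ereal_inf_tmp => _ [mu muP <-].
  have [xi [adm [t [w [lw muw]]]]] := rep mu muP.
  rewrite (action_represented d_gt0 hL n0_odd adm lw muw vP) lee_fin lerDl.
  exact: (mean_gap_ge0 d_gt0 c hL n0_odd adm lw).
- by move=> z [mu mumin sz]; exact: (minsup mu mumin).
- move=> z /(_ v vP) [m [k [pm ->]]].
  exists m, (k + 1), (Ham_p L (xg R N m) (tg R K k) (c + Dx N (v^~ k) m)).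
  split=> //; apply: Hp_box; rewrite -tgrid_step.
  by have [] := pm.
Qed.
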